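(* Let $V$ be a finite set, let $P=(P_{xy})_{x,y\in V}$ be a sub-Markovian transition matrix whose associated discrete-time Markov chain is transient, and let $\alpha>0$. Let $\mathcal{L}_\alpha$ be the associated unrooted oriented loop soup with intensity $\alpha$, and let $\theta=(\theta_x)_{x\in V}$ and $N=(N_{xy})_{x,y\in V}$ be its occupation time fields on vertices and on edges, respectively. Suppose $P$ is associated to a $*$-forest. Let $E=E(P):=\{\{x,y\}:x,y\in V,\ P_{xy}\ne0\text{ or }P_{yx}\ne0\}$ ($\{x,x\}\in E$ if $P_{xx}\ne0$). Then for any $\mathbf{q}=(q_x)_{x\in V}\in\mathbb{N}^V$ and $\mathbf{n}=(n_{xy})_{x,y\in V}\in T_{\mathbf{q}}(P)$, $$\mathbb{P}(N=\mathbf{n})=\frac{\det(I-P)^\alpha}{\Gamma(\alpha)}\cdot\frac{\prod_{x\in V}\Gamma(q_x+\alpha)}{\prod_{\{x,y\}\in E}n_{xy}!\ \prod_{\{x,y\}\in E:\,x\ne y}\Gamma(n_{xy}+\alpha)}\prod_{x,y\in V}P_{xy}^{n_{xy}},$$ and consequently, $$\mathbb{P}(\theta=\mathbf{q})=\frac{\det(I-P)^\alpha}{\Gamma(\alpha)}\cdot\sum_{\mathbf{n}\in T_{\mathbf{q}}(P)}\frac{\prod_{x\in V}\Gamma(q_x+\alpha)}{\prod_{\{x,y\}\in E}n_{xy}!\ \prod_{\{x,y\}\in E:\,x\ne y}\Gamma(n_{xy}+\alpha)}\prod_{x,y\in V}P_{xy}^{n_{xy}}.$$ In particular, if $P$ is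 associated to a forest, then for any $\mathbf{q}\in\mathbb{N}^V$ there is exactly one element, say $\mathbf{n}_{\mathbf{q}}$, in $T_{\mathbf{q}}(P)$. Hence it holds that $$\mathbb{P}(\theta=\mathbf{q})=\mathbb{P}(N=\mathbf{n}_{\mathbf{q}}).$$
   Context: $\mathbb{N}=\{0,1,2,\dots\}$, and $0^0:=1$. Sub-Markovian means $P_{xy}\ge 0$ and $\sum_{y}P_{xy}\le 1$ for all $x$. The associated Markov chain $(X_n)_{0\le n<\zeta}$, being at $x$, jumps to $y$ with probability $P_{xy}$ and is killed with probability $1-\sum_yP_{xy}$. Under transience the Green's function $G(x,y)=E^x\big(\sum_{n=0}^{\zeta-1}1_{\{X_n=y\}}\big)$ is finite for all $x,y\in V$. Graph of $P$: the undirected graph $\mathbb{G}(P)=(V,E)$ with $E$ as in the claim. A graph is a $*$-forest if it has no cycles other than self-loops; a forest has no cycles and no self-loops. $P$ is associated to a $*$-forest (resp. forest) if $\mathbb{G}(P)$ is a $*$-forest (resp. forest). $T_{\mathbf{q}}(P)$ is the set of $\mathbf{n}=(n_{xy})\in\mathbb{N}^{V\times V}$ such that (1) $n_{xy}=0$ whenever $\{x,y\}\notin E$; (2) $\sum_{y}n_{xy}=\sum_y n_{yx}$ for all $x\in V$; (3) $\sum_y n_{xy}=q_x$ for all $x\in V$. (When $\mathbb{G}(P)$ is a $*$-forest, under (1), condition (2) is equivalent to $n_{xy}=n_{yx}$ for all $\{x,y\}\in E$, so products over unordered edges are well defined.) Loop soup: a rooted loop is a discrete-time path $(x_0,x_1,\dots,x_n)$,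 $n\ge1$, on $\mathbb{G}(P)$ with $x_n=x_0$ and each $\{x_i,x_{i+1}\}\in E$. An unrooted loop is obtained by forgetting the starting point of a rooted loop (an equivalence class under cyclic shift). The multiplicity $J(\gamma)$ of an unrooted loop $\gamma$ is the maximal integer $J$ such that $\gamma$ can be written as the concatenation of $J$ identical unrooted loops. The loop measure $\mu$ on the set of unrooted loops is $\mu(\{\gamma\})=\frac{1}{J(\gamma)}\prod_{i=0}^{n-1}P_{x_ix_{i+1}}$ for $\gamma$ the class of $(x_0,\dots,x_n)$. The oriented loop soup $\mathcal{L}_\alpha$ with intensity $\alpha$ is a Poisson point process on the space of unrooted loops with intensity measure $\alpha\mu$. Occupation time fields: $\theta_x$ is the sum, over the loops in $\mathcal{L}_\alpha$ (with repetition), of the number of visits at $x$, and $N_{xy}$ is the sum, over the loops in $\mathcal{L}_\alpha$ (with repetition), of the number of crossings from $x$ to $y$. The class of $(x_0,\dots,x_n)$ visits $x$ exactly $\#\{0\le i<n:x_i=x\}$ times and crosses from $x$ to $y$ exactly $\#\{0\le i<n:(x_i,x_{i+1})=(x,y)\}$ times.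
   Formalization: The prefactor is det(I-P)^α/Γ(α)^c, c the number of connected components of the graph of P (the printed Γ(α) fails when c≠1, e.g. two vertices, P=0); for a forest, uniqueness of n_q and P(θ=q)=P(N=n_q) are stated when T_q(P) is nonempty, since T_q(P) can be empty. *)

(* Defs.v *)
From HB Require Import structures.
From mathcomp Require Import all_boot all_order all_algebra.
From mathcomp Require Import all_classical all_reals all_analysis.

Set Implicit Arguments.
Unset Strict Implicit.
Unset Printing Implicit Defensive.

Import Order.TTheory GRing.Theory Num.Theory.
Import numFieldNormedType.Exports.

Local Open Scope classical_set_scope.
Local Open Scope ring_scope.

Definition Gamma (R : realType) (a : R) : R :=
  Rintegral (@lebesgue_measure R) `]0, +oo[ (fun t => t `^ (a - 1) * expR (- t)).

Section TransitionMatrix.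
Context {R : realType} {V : finType}.
Implicit Types (P : V -> V -> R) (x y : V).

Definition submarkov P : Prop :=
  (forall x y, 0 <= P x y) /\ (forall x, \sum_y P x y <= 1).

Definition tmx P : 'M[R]_#|V| := \matrix_(i, j) P (enum_val i) (enum_val j).

(* P^x (X_k = y, k < zeta) *)
Definition nstep P (k : nat) x y : R := (tmx P ^+ k) (enum_rank x) (enum_rank y).

Definition green P x y : \bar R := (\sum_(0 <= k <oo) (nstep P k x y)%:E)%E.

Definition transient P : Prop := forall x y, (green P x y < +oo)%E.

Definition edge P : rel V := fun x y => (P x y != 0) || (P y x != 0).

Lemma edge_sym P : symmetric (edge P).
Proof. by move=> x y; rewrite /edge orbC. Qed.

(* As edge P is the adjacency relation of a graph without multiple edges,
   a cycle which is not a self-loop visits at least three distinct vertices. *)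
Definition star_forest P : Prop :=
  forall s : seq V, ucycle (edge P) s -> (size s <= 2)%N.

Definition forest P : Prop := star_forest P /\ (forall x, ~~ edge P x x).

(* The number of connected components of the graph of P. The field factorizes
   over them, each contributing a factor 1 / Gamma alpha to the density. *)
Definition ncomp P : nat := n_comp (edge P) V.

(* Each unordered edge {x, y} is represented once, by the ordered pair which
   is increasing for the enumeration of V. *)
Definition oedges P : {set V * V} :=
  [set e | edge P e.1 e.2 && (enum_rank e.1 <= enum_rank e.2)%N].

Definition Tq P (q : V -> nat) : set {ffun V * V -> nat} :=
  [set n | [/\ forall x y, ~~ edge P x y -> n (x, y) = 0%N,
               forall x, (\sum_y n (x, y) = \sum_y n (y, x))%N &
               forall x, (\sum_y n (x, y))%N = q x]].

(* Hence the finitely supported sums over Tq P q are the genuine ones. *)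
Lemma finite_Tq P q : finite_set (Tq P q).
Proof.
pose m := (\max_x q x)%N.
pose f (g : {ffun V * V -> 'I_m.+1}) : {ffun V * V -> nat} :=
  [ffun e => nat_of_ord (g e)].
apply: (@sub_finite_set _ _ (f @` setT)); last first.
  by apply: finite_image; exact: finite_finset.
move=> n [_ _ nq]; exists [ffun e => inord (n e)] => //.
apply/ffunP => -[x y]; rewrite !ffunE inordK// ltnS.
apply: leq_trans (leq_bigmax x).
by rewrite -nq (bigD1 y)//= leq_addr.
Qed.

(* The n-dependent factor of the density. For a *-forest, every n in Tq P q is
   symmetric, so the choice made in oedges is immaterial. *)
Definition field_term P (alpha : R) (q : V -> nat) (n : {ffun V * V -> nat}) : R :=
  (\prod_x Gamma ((q x)%:R + alpha)) /
  ((\prod_(e in oedges P) (n e)`!%:R) *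
   (\prod_(e in oedges P | e.1 != e.2) Gamma ((n e)%:R + alpha))) *
  \prod_x \prod_y P x y ^+ n (x, y).

(* A rooted loop (x_0, ..., x_n) with x_n = x_0 is encoded as
   [:: x_0; ...; x_(n-1)]. *)
Definition rloop P : Type := {s : seq V | (s != [::]) && cycle (edge P) s}.

(* the pairs (x_i, x_(i+1)), 0 <= i < n *)
Definition steps (s : seq V) : seq (V * V) := zip s (rot 1 s).

Definition shift_equiv P : rel (rloop P) :=
  fun s t => [exists k : 'I_(size (val s)), val t == rot k (val s)].

Lemma shift_equivP P (s t : rloop P) :
  reflect (exists k, val t = rot k (val s)) (shift_equiv s t).
Proof.
apply: (iffP existsP) => [[k /eqP ->]|[k tk]]; first by exists k.
have s0 : (0 < size (val s))%N by case: s {tk} => -[].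
have [ks|sk] := ltnP k (size (val s)); first by exists (Ordinal ks); apply/eqP.
by exists (Ordinal s0); rewrite tk rot_oversize//= rot0.
Qed.

Lemma shift_equiv_refl P : reflexive (@shift_equiv P).
Proof. by move=> s; apply/shift_equivP; exists 0%N; rewrite rot0. Qed.

Lemma shift_equiv_sym P : symmetric (@shift_equiv P).
Proof.
suff H s t : @shift_equiv P s t -> shift_equiv t s.
  by move=> s t; apply/idP/idP; exact: H.
case/shift_equivP => k tk; apply/shift_equivP.
by exists (size (val s) - k)%N; rewrite tk -(size_rot k) -/(rotr k _) rotK.
Qed.

Lemma shift_equiv_trans P : transitive (@shift_equiv P).
Proof.
move=> t s u /shift_equivP[k tk] /shift_equivP[l ul]; apply/shift_equivP.
rewrite ul tk.
have [ks|/ltnW ks] := leqP k (size (val s)); last by rewrite (rot_oversize ks); exists l.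
have [ls|/ltnW ls] := leqP l (size (val s)).
  by rewrite rot_add_mod//; eexists.
by rewrite rot_oversize ?size_rot//; exists k.
Qed.

Canonical shift_equiv_rel P :=
  EquivRel (@shift_equiv P) (@shift_equiv_refl P) (@shift_equiv_sym P)
           (@shift_equiv_trans P).

Definition uloop P : Type := {eq_quot (shift_equiv_rel P)}%qT.

Definition lseq P (g : uloop P) : seq V := val (repr g).

Definition visits P (g : uloop P) x : nat := count_mem x (lseq g).

Definition crossings P (g : uloop P) x y : nat := count_mem (x, y) (steps (lseq g)).

Definition weight P (g : uloop P) : R := \prod_(e <- steps (lseq g)) P e.1 e.2.

Lemma lseq_pi P (s : rloop P) :
  exists k, lseq (\pi_(uloop P)%qT s) = rot k (val s).
Proof.
by apply/shift_equivP; have /eqquotP := esym (reprK (\pi_(uloop P)%qT s)).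
Qed.

Lemma steps_rot k s : steps (rot k s) = rot k (steps s).
Proof.
have [ks|/ltnW sk] := leqP k (size s); last first.
  by rewrite !rot_oversize ?size_zip ?size_rot ?minnn.
rewrite /steps; have -> : rot 1 (rot k s) = rot k (rot 1 s) by exact: rot_rot.
set t := rot 1 s; have st : size s = size t by rewrite size_rot.
have szt : size (zip (take k s) (take k t)) = k.
  by rewrite size_zip !size_takel -?st// minnn.
have -> : zip s t = zip (take k s) (take k t) ++ zip (drop k s) (drop k t).
  by rewrite -zip_cat ?cat_take_drop// !size_takel -?st.
have rotE u v : size u = k -> rot k (u ++ v) = v ++ u :> seq (V * V).
  by move=> <-; rewrite rot_size_cat.
by rewrite (rotE _ _ szt) /rot zip_cat// !size_drop st.
Qed.

Lemma visits_pi P (s : rloop P) x : visits (\pi_(uloop P)%qT s) x = count_mem x (val s).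
Proof. rewrite /visits; have [k ->] := lseq_pi s; exact/permP/permPl/perm_rot. Qed.

Lemma crossings_pi P (s : rloop P) x y :
  crossings (\pi_(uloop P)%qT s) x y = count_mem (x, y) (steps (val s)).
Proof.
rewrite /crossings; have [k ->] := lseq_pi s; rewrite steps_rot.
exact/permP/permPl/perm_rot.
Qed.

Lemma weight_pi P (s : rloop P) :
  weight (\pi_(uloop P)%qT s) = \prod_(e <- steps (val s)) P e.1 e.2.
Proof.
rewrite /weight; have [k ->] := lseq_pi s; rewrite steps_rot.
by apply: perm_big; rewrite perm_rot.
Qed.

(* The bound j <= size (lseq g) loses nothing, t being nonempty. *)
Definition multiplicity P (g : uloop P) : nat :=
  \max_(j < (size (lseq g)).+1 |
        `[< exists s t : rloop P,
              \pi_(uloop P)%qT s = g /\ val s = flatten (nseq j (val t)) >]) j.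

Definition loop_measure P (A : set (uloop P)) : \bar R :=
  (\esum_(g in A) ((multiplicity g)%:R^-1 * weight g)%:E)%E.

End TransitionMatrix.

Section PoissonPointProcess.
Context {R : realType} {d : measure_display} {Omega : measurableType d}.

(* A point process on a countable discrete space T, with repetition: L w g is
   the number of occurrences of the point g. *)
Definition npoints (T : choiceType) (L : Omega -> T -> nat) (A : set T) (w : Omega)
  : \bar R := (\esum_(g in A) (L w g)%:R%:E)%E.

Definition poisson_process (T : choiceType) (Pr : probability Omega R)
    (nu : set T -> \bar R) (L : Omega -> T -> nat) : Prop :=
  [/\ (forall g, measurable_fun setT (fun w => L w g)),
      (forall (A : set T) (k : nat), (nu A < +oo)%E ->
         (* the library's poisson_pmf is unsuitable here: it is 1 at rate 0 *)
         Pr [set w | npoints L A w = k%:R%:E] =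
           (fine (nu A) ^+ k / k`!%:R * expR (- fine (nu A)))%:E) &
      (forall (m : nat) (A : 'I_m -> set T) (k : 'I_m -> nat),
         trivIset setT A -> (forall i, nu (A i) < +oo)%E ->
         Pr [set w | forall i, npoints L (A i) w = (k i)%:R%:E] =
           (\prod_(i < m) Pr [set w | npoints L (A i) w = (k i)%:R%:E])%E)].

Context {V : finType}.
Variable P : V -> V -> R.

Definition loop_soup (Pr : probability Omega R) (alpha : R)
    (L : Omega -> uloop P -> nat) : Prop :=
  poisson_process Pr (fun A => (alpha%:E * loop_measure A)%E) L.

Definition theta (L : Omega -> uloop P -> nat) (w : Omega) (x : V) : \bar R :=
  (\esum_(g in [set: uloop P]) (L w g * visits g x)%N%:R%:E)%E.

Definition edge_field (L : Omega -> uloop P -> nat) (w : Omega) (x y : V) : \bar R :=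
  (\esum_(g in [set: uloop P]) (L w g * crossings g x y)%N%:R%:E)%E.

Definition theta_eq (L : Omega -> uloop P -> nat) (q : V -> nat) : set Omega :=
  [set w | forall x, theta L w x = (q x)%:R%:E].

Definition edge_field_eq (L : Omega -> uloop P -> nat) (n : {ffun V * V -> nat}) :
    set Omega :=
  [set w | forall x y, edge_field L w x y = (n (x, y))%:R%:E].

End PoissonPointProcess.

(* Main.v *)
From mathcomp Require Import all_boot all_order all_algebra.
From mathcomp Require Import all_classical all_reals all_analysis.
From mathcomp Require Import measurable_realfun ring lra zify.
Require Import Defs.

(** The field N takes the value n only if no loop of the soup has more than K
steps, K being the sum of the entries of n; so the event is a finite disjoint
union of events which prescribe how often each of the finitely many short
loops occurs and forbid all the longer ones. The Poisson counts being
independent, with J the multiplicity and c the crossings of a loop,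

  Pr (N = n) = exp (- alpha mu) * prod P^n * C n,
  C n = sum over (k_g) with sum_g k_g c_g = n of prod_g (alpha / J_g)^k_g / k_g!

where mu is the total mass of the loop measure (Pr_edge_field_eq). The event
{theta = q} is the disjoint union of the events {N = n} for n in Tq P q
(theta_edge_field), whence the second formula from the first.

Loops and rooted loops. A loop g has exactly (visits of g at x) / J_g rooted
representatives starting at x (count_rooted_reps). Hence a sum over loops
weighted by visits / J is a sum over the closed walks starting at x
(sum_loops). This is used twice.

Total mass. Writing 1 as the sum over x of visits / length, the mass is the
sum over k of tr P^k / k, and it remains to see that exp (- mu) = det (I - P)
(loop_mass_total). On [0, 1] consider u_N(t) = det (I - t P) exp (sum_(k <= N)
t^k tr P^k / k). By the formula of Jacobi for the derivative of a determinant,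
the derivative of u_N telescopes to - t^N tr (P^(N+1) adj (I - t P)) times the
exponential, which tends to 0 uniformly because the chain is transient; so
u_N(1) tends to u_N(0) = 1 by the mean value theorem (det_expR_trace).

Combinatorics. C is the family of coefficients of the exponential of the
generating function of loops, and the Euler operator which multiplies the
coefficient of z^n by q_x, the number of crossings out of x, gives the
recurrence

  q_x C n = alpha * sum over nonempty closed walks w from x of C (n - c w)

(exp_coef_deriv, sum_loops). Together with C 0 = 1 it determines C, so one has
to check that the explicit density D (field_density) satisfies it when the
graph is a *-forest (exp_coef_loops). More generally, the sum of D (n - c w)
over the walks w from a to x has a closed form (green_density): it is the
coefficient of z^n in the product of the Green's function and det^(- alpha).
The closed form is checked by conditioning on the first step
(green_density_step). A step alters the factors of a single edge and a single
vertex, and the alterations add up correctly because the crossings left to be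
made stay symmetric except along the unique simple path from the current
vertex back to x, where they exceed the opposite ones by one (flow_along,
flow_along_decr). Of the Gamma function only Gamma (a + 1) = a Gamma a and its
positivity intervene. D 0 = 1 says that the number of vertices is the number
of edges other than self-loops plus the number of components
(card_nonloop_edges).

Shape of Tq P q. A flow which is not symmetric, or two distinct flows on a
forest with the same q, would produce a simple path which can be prolonged
forever (dead_end_free_rel); hence Tq_sym and Tq_inj. *)
Set Implicit Arguments.
Unset Strict Implicit.
Unset Printing Implicit Defensive.

Import Order.TTheory GRing.Theory Num.Theory.
Import numFieldNormedType.Exports.

Local Open Scope classical_set_scope.
Local Open Scope ring_scope.

(** * The functional equation of the Gamma function *)

Section GammaFunction.
Context {R : realType}.
Implicit Types a x y : R.
Local Notation mu := (@lebesgue_measure R).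

Let g a : R -> R := fun t => t `^ (a - 1) * expR (- t).

(** The margin left between the exponents 1/2 and 1 serves twice: it makes
x^a exp (- x) vanish at infinity, and it dominates the integrand of Gamma by a
multiple of an exponential density. *)
Lemma powR_expR_bound a : 0 < a -> exists2 C : R, 0 <= C &
  forall x, 0 < x -> x `^ a <= C * expR (2^-1 * x).
Proof.
move=> a0; pose m := (Num.truncn a).+1.
have am : a <= m%:R by rewrite ltW// truncnS_gt.
exists (1 + 2 ^+ m * m`!%:R) => [|x x0].
  by rewrite addr_ge0// mulr_ge0// exprn_ge0.
have e1 : 1 <= expR (2^-1 * x) by rewrite -expR0 ler_expR mulr_ge0// ltW.
have em : x ^+ m <= 2 ^+ m * m`!%:R * expR (2^-1 * x).
  have hx0 : 0 <= 2^-1 * x by rewrite mulr_ge0// ltW.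
  have h := expR_ge1Dxn (Num.truncn a) hx0; rewrite -/m in h.
  have {}h : (2^-1 * x) ^+ m / m`!%:R <= expR (2^-1 * x).
    by apply: le_trans h; rewrite lerDr.
  move: h; rewrite ler_pdivrMr ?ltr0n ?fact_gt0// => h.
  have -> : x ^+ m = 2 ^+ m * (2^-1 * x) ^+ m.
    by rewrite -exprMn mulrA divff// mul1r.
  by rewrite -mulrA ler_pM2l ?exprn_gt0// [leRHS]mulrC.
rewrite mulrDl mul1r; have [x1|x1] := leP x 1.
  apply: le_trans (_ : 1 <= _); last first.
    by rewrite (le_trans e1)// lerDl !mulr_ge0// ?exprn_ge0// expR_ge0.
  have := @ge0_ler_powR _ a (ltW a0) x 1.
  by rewrite !nnegrE powR1; apply => //; exact: ltW.
apply: le_trans (_ : x ^+ m <= _); last by rewrite (le_trans em)// lerDr expR_ge0.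
by rewrite -powR_mulrn ?(ltW x0)//; apply: ler_powR => //; exact: ltW.
Qed.

Lemma powR_expRN_cvg0 a : 0 < a -> x `^ a * expR (- x) @[x --> +oo] --> (0 : R).
Proof.
move=> a0; have [C C0 aC] := powR_expR_bound a0.
apply: (@squeeze_cvgr _ _ _ _ (fun=> 0) (fun x => C * expR (- (2^-1 * x)))).
- near=> x; rewrite mulr_ge0 ?powR_ge0 ?expR_ge0//=.
  have -> : - (2^-1 * x) = 2^-1 * x + - x by field.
  rewrite expRD mulrA ler_wpM2r ?expR_ge0// aC//.
- exact: cvg_cst.
- rewrite -[X in _ --> X](mulr0 C); apply: cvgM; first exact: cvg_cst.
  apply: (@cvg_comp _ _ _ (fun x : R => 2^-1 * x) (fun y => expR (- y)) _ +oo);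
    last exact: cvgr_expR.
  exact: gt0_cvgMry.
Unshelve. all: by end_near. Qed.

Lemma continuous_gamma_fun a x : 0 < x -> {for x, continuous (g a)}.
Proof.
move=> x0; apply: continuousM.
  apply: differentiable_continuous; apply/derivable1_diffP.
  by apply: derivable_powR; rewrite in_itv/= x0.
by apply: continuous_comp; [exact: oppr_continuous|exact: continuous_expR].
Qed.

Lemma measurable_gamma_fun a : measurable_fun `](0 : R), +oo[ (g a).
Proof.
apply: open_continuous_measurable_fun => // x.
by rewrite inE/= in_itv/= andbT => x0; exact: continuous_gamma_fun.
Qed.

Lemma gamma_fun_ge0 a x : 0 <= g a x.
Proof. by rewrite mulr_ge0 ?powR_ge0 ?expR_ge0. Qed.

Lemma gamma_by_parts a x y : 0 < a -> 0 < x -> x < y ->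
  (\int[mu]_(t in `[x, y]) (g (a + 1) t)%:E =
   (x `^ a * expR (- x) - y `^ a * expR (- y))%:E
   + a%:E * \int[mu]_(t in `[x, y]) (g a t)%:E)%E.
Proof.
move=> a0 x0 xy.
have inxy t : t \in `[x, y] -> 0 < t.
  by rewrite in_itv/= => /andP[xt _]; exact: lt_le_trans xt.
have cfor (f : R -> R) : (forall t, 0 < t -> {for t, continuous f}) ->
    {within `[x, y], continuous f}.
  move=> cf; apply/subspace_continuousP => t txy; apply: cvg_within_filter.
  by apply: cf; exact: inxy.
have cexp t : {for t, continuous (fun t : R => expR (- t))}.
  by apply: continuous_comp; [exact: oppr_continuous|exact: continuous_expR].
have dexp (t : R) : is_derive t (1 : R) (fun t : R => - expR (- t)) (expR (- t)).
  by apply: is_derive_eq; rewrite mulrN1 opprK.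
have lr (F : R -> R) : (forall t, 0 < t -> derivable F t 1) ->
    derivable_oo_LRcontinuous F x y.
  move=> dF; have cF t : 0 < t -> {for t, continuous F}.
    by move=> t0; apply: differentiable_continuous; apply/derivable1_diffP/dF.
  split.
  - by move=> t /subset_itv_oo_cc/inxy; exact: dF.
  - by apply: cvg_at_right_filter; exact: cF.
  - by apply: cvg_at_left_filter; apply: cF; exact: lt_trans xy.
have := @integration_by_parts R (fun t => t `^ a) (fun t => - expR (- t))
  (fun t => a * t `^ (a - 1)) (fun t => expR (- t)) x y xy.
move=> /(_ _ _ _ _ _ _)/wrap[].
- apply: cfor => t t0; apply: continuousM; first exact: cst_continuous.
  apply: differentiable_continuous; apply/derivable1_diffP.
  by apply: derivable_powR; rewrite in_itv/= t0.
- by apply: lr => t t0; apply: derivable_powR; rewrite in_itv/= t0.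
- move=> t txy; apply: powR_derive1; rewrite in_itv/= andbT.
  by apply: inxy; exact: subset_itv_oo_cc.
- by apply: cfor => t _; exact: cexp.
- by apply: lr => t _; exact: ex_derive.
- by move=> t _; rewrite derive1E; exact: derive_val.
have -> : (\int[mu]_(t in `[x, y]) ((a * t `^ (a - 1) * (- expR (- t)))%:E) =
    (- a)%:E * \int[mu]_(t in `[x, y]) (g a t)%:E)%E.
  rewrite -integralZl//=; last first.
    apply: continuous_compact_integrable => //; first exact: segment_compact.
    by apply: cfor => t; exact: continuous_gamma_fun.
  by apply: eq_integral => t _; rewrite -EFinM; congr EFin; rewrite /g; ring.
rewrite EFinN mulNe oppeK /g addrK => ->; congr (_ + _)%E; congr EFin; ring.
Qed.

Let gammaE a : \bar R := (\int[mu]_(t in `]0%R, +oo[) (g a t)%:E)%E.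

Lemma Gamma_fine a : Gamma a = fine (gammaE a).
Proof. by []. Qed.

(** Integration by parts on [1 / (n + 2), n + 2], whose boundary terms vanish
as n grows. The integrals are kept in the extended reals, so that the equation
is available before Gamma a is known to be finite. *)
Lemma gammaE_succ a : 0 < a -> (gammaE (a + 1) = a%:E * gammaE a)%E.
Proof.
move=> a0; pose F (n : nat) : set R := `[n.+2%:R^-1, n.+2%:R]%classic.
have F0 n : 0 < n.+2%:R^-1 :> R by rewrite invr_gt0 ltr0n.
have cvF b : ((\int[mu]_(t in F i) (g b t)%:E) @[i --> \oo] --> gammaE b)%E.
  rewrite /gammaE (_ : `]0%R, +oo[%classic = \bigcup_i F i); last first.
    apply/seteqP; split => [t|t [n _]]; rewrite /F/= !in_itv/=; last first.
      by move=> /andP[h _]; rewrite andbT (lt_le_trans _ h).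
    rewrite andbT => t0.
    pose m := Num.max t t^-1; have m0 : 0 <= m by rewrite le_max (ltW t0).
    have mt : m <= (Num.truncn m).+2%:R.
      by rewrite (le_trans (ltW (truncnS_gt m)))// ler_nat.
    exists (Num.truncn m) => //; rewrite /F/= in_itv/=; apply/andP; split.
      by rewrite invf_ple ?posrE ?ltr0n// (le_trans _ mt)// le_max lexx orbT.
    by rewrite (le_trans _ mt)// le_max lexx.
  apply: ge0_nondecreasing_set_cvg_integral => //.
  - move=> m n mn; apply/subsetPset => t; rewrite /F/= !in_itv/= => /andP[h1 h2].
    apply/andP; split; last by rewrite (le_trans h2)// ler_nat.
    by rewrite (le_trans _ h1)// lef_pV2 ?posrE ?ltr0n// ler_nat.
  - by move=> n; exact: measurable_itv.
  - move=> n; apply/measurable_EFinP; apply: measurable_funS (measurable_gamma_fun b) => //.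
    by move=> t; rewrite /F/= !in_itv/= andbT => /andP[h _]; exact: lt_le_trans h.
  - by move=> n t _; rewrite lee_fin gamma_fun_ge0.
have ny : ((n.+2%:R : R) @[n --> \oo] --> +oo)%R.
  apply/cvgryPge => A; near=> n.
  apply: (@le_trans _ _ n%:R); last by rewrite ler_nat leqW.
  by near: n; exact: nbhs_infty_ger.
have nV : ((n.+2%:R : R)^-1 @[n --> \oo] --> 0^'+)%R.
  have nV0 : ((n.+2%:R : R)^-1 @[n --> \oo] --> 0)%R.
    by apply/(@gtr0_cvgV0 _ _ _ _ (fun n => n.+2%:R)); first exact: nearW.
  move=> A hA.
  have : \forall n \near \oo, 0 < n.+2%:R^-1 -> A n.+2%:R^-1 := nV0 _ hA.
  by apply: filterS => n; apply; exact: F0.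
have bd0 : x `^ a * expR (- x) @[x --> 0^'+] --> (0 : R).
  rewrite -[X in _ --> X](mul0r (expR (- 0))).
  apply: cvgM; first exact: powR_cvg0.
  apply: cvg_at_right_filter.
  by apply: continuous_comp; [exact: oppr_continuous|exact: continuous_expR].
have bd1 := cvg_comp _ _ nV bd0.
have bd2 := cvg_comp _ _ ny (powR_expRN_cvg0 a0).
suff cvG : ((\int[mu]_(t in F i) (g (a + 1) t)%:E) @[i --> \oo] --> a%:E * gammaE a)%E.
  exact: (cvg_unique _ (cvF (a + 1)) cvG).
rewrite -(add0e (_ * _)%E).
have -> : (fun i => \int[mu]_(t in F i) (g (a + 1) t)%:E)%E =
  (fun n => ((n.+2%:R : R)^-1 `^ a * expR (- n.+2%:R^-1) - n.+2%:R `^ a * expR (- n.+2%:R))%:E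
   + a%:E * \int[mu]_(t in F n) (g a t)%:E)%E.
  apply/funext => n; rewrite /F gamma_by_parts//.
  by rewrite (@lt_trans _ _ 1)// ?invf_lt1 ?ltr1n// ltr0n.
apply: cvgeD.
- by rewrite fin_num_adde_defr.
- apply: cvg_EFin; first by apply: nearW.
  by rewrite -[X in _ --> X](subr0 0); exact: cvgB bd1 bd2.
- by apply: cvgeZl.
Unshelve. all: by end_near. Qed.

(** For an argument above 1 the integrand has no singularity at 0, hence a
domination by an exponential density suffices. *)
Lemma gammaE_succ_lty a : 0 < a -> (gammaE (a + 1) < +oo)%E.
Proof.
move=> a0; have [C C0 aC] := powR_expR_bound a0.
have -> : (gammaE (a + 1) = \int[mu]_(t in `]0%R, +oo[) (t `^ a * expR (- t))%:E)%E.
  by apply: eq_integral => t _; rewrite /g addrK.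
apply: (@le_lt_trans _ _ (\int[mu]_t ((2 * C)%:E * (exponential_pdf 2^-1 t)%:E))%E).
  rewrite integral_mkcond; apply: ge0_le_integral => //.
  - by move=> t _; apply: erestrict_ge0 => s _; rewrite lee_fin mulr_ge0 ?powR_ge0 ?expR_ge0.
  - apply/(measurable_restrictT _ _).1 => //; apply/measurable_EFinP.
    by have := measurable_gamma_fun (a + 1); rewrite /g addrK.
  - by apply: measurable_funeM; apply/measurable_EFinP; exact: measurable_exponential_pdf.
  - move=> t _; rewrite /patch; case: ifPn => [|_]; last first.
      by rewrite -EFinM lee_fin mulr_ge0// ?mulr_ge0// exponential_pdf_ge0.
    rewrite inE/= in_itv/= andbT => t0.
    rewrite -EFinM lee_fin exponential_pdfE ?(ltW t0)//.
    (* half of the decay absorbs t^a, the other half is the density *)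
    have -> : - t = - (2^-1 * t) - 2^-1 * t by field.
    rewrite expRD mulrA.
    apply: (@le_trans _ _ (C * expR (- 2^-1 * t))); last by rewrite mulNr; lra.
    rewrite mulNr ler_wpM2r ?expR_ge0//.
    by rewrite expRN -ler_pdivlMr ?invr_gt0 ?expR_gt0// invrK aC.
rewrite ge0_integralZl_EFin//= ?mulr_ge0//.
- by rewrite integral_exponential_pdf// mule1 ltry.
- by move=> t _; rewrite lee_fin exponential_pdf_ge0.
- by apply/measurable_EFinP; exact: measurable_exponential_pdf.
Qed.

Lemma gammaE_ge0 a : (0 <= gammaE a)%E.
Proof. by apply: integral_ge0 => t _; rewrite lee_fin gamma_fun_ge0. Qed.

Lemma gammaE_gt0 a : 0 < a -> (0 < gammaE a)%E.
Proof.
move=> a0; rewrite lt0e gammaE_ge0 andbT; apply/eqP => G0.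
have := @ge0_subset_integral _ _ R mu `[1, 2]%classic `]0, +oo[%classic
  _ _ (EFin \o g a).
rewrite /= -/(gammaE a) G0 => /(_ _ _ _ _ _)/wrap[]//.
- by apply/measurable_EFinP; exact: measurable_gamma_fun.
- by move=> t _; rewrite lee_fin gamma_fun_ge0.
- by move=> t; rewrite /= !in_itv/= andbT => /andP[h _]; exact: lt_le_trans h.
apply/negP; rewrite -ltNge.
apply: (@lt_le_trans _ _ (\int[mu]_(t in `[1%R, 2%R]) (2^-1 * expR (- 2))%:E)%E).
  rewrite integral_cst//= lebesgue_measure_itv/= lte_fin ltr1n/=.
  by rewrite -EFinB -EFinM lte_fin !mulr_gt0// ?expR_gt0// subr_gt0 ltr1n.
apply: ge0_le_integral => //=.
- apply/measurable_EFinP; apply: measurable_funS (measurable_gamma_fun a) => //.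
  by move=> t; rewrite /= !in_itv/= andbT => /andP[h _]; exact: lt_le_trans h.
move=> t; rewrite in_itv/= => /andP[t1 t2]; rewrite lee_fin.
apply: ler_pM => //; rewrite ?expR_ge0 ?ler_expR ?lerN2//.
have t0 : 0 < t by exact: lt_le_trans t1.
have -> : t `^ (a - 1) = t `^ a / t.
  by rewrite powRB ?powRr1 ?(ltW t0)// (gt_eqF t0) implybT.
apply: (@le_trans _ _ t^-1); first by rewrite lef_pV2 ?posrE.
rewrite ler_peMl ?invr_ge0 ?(ltW t0)// -(powRr0 t).
by apply: ler_powR => //; exact: ltW.
Qed.

(** The functional equation carries finiteness from a + 1 down to a, so that
the singularity of the integrand at 0 never has to be estimated. *)
Lemma gammaE_fin_num a : 0 < a -> gammaE a \is a fin_num.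
Proof.
move=> a0; rewrite ge0_fin_numE ?gammaE_ge0//.
have := gammaE_succ_lty a0; rewrite gammaE_succ//.
by case: (gammaE a) => [r||] //; rewrite ?ltry ?ltNyr ?gt0_muley ?lte_fin.
Qed.

Lemma Gamma_succ a : 0 < a -> Gamma (a + 1) = a * Gamma a.
Proof. by move=> a0; rewrite !Gamma_fine gammaE_succ// fineM// gammaE_fin_num. Qed.

Lemma Gamma_gt0 a : 0 < a -> 0 < Gamma a.
Proof.
move=> a0; rewrite Gamma_fine fine_gt0// gammaE_gt0//=.
by rewrite -ge0_fin_numE ?gammaE_ge0// gammaE_fin_num.
Qed.

End GammaFunction.

(** * The logarithm of det (I - P) as a sum of traces *)

Section DeterminantDerivative.

Lemma deriv_prod (R : comNzRingType) (I : eqType) (r : seq I) (F : I -> {poly R}) :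
  uniq r ->
  (\prod_(i <- r) F i)^`() = \sum_(i <- r) (F i)^`() * \prod_(j <- r | j != i) F j.
Proof.
elim: r => [|a r IH]/=; first by rewrite !big_nil derivC.
move=> /andP[ar ur]; rewrite !big_cons derivM IH// eqxx /=; congr (_ * _ + _).
  by rewrite [RHS]big_seq_cond [LHS]big_seq_cond; apply: eq_bigl => j; have [->|] := eqVneq j a;
    rewrite ?(negbTE ar)//= andbT.
rewrite mulr_sumr; apply: eq_big_seq => i ir.
rewrite big_cons ifT; last by apply: contraNneq ar => ->.
by rewrite mulrCA.
Qed.

(** Jacobi's formula: by the Leibniz expansion the derivative is the sum of
the determinants in which one row is differentiated, and each of them is
expanded along this row. *)
Lemma deriv_det (R : comNzRingType) n (M : 'M[{poly R}]_n) :
  (\det M)^`() = \tr (map_mx (@deriv R) M *m \adj M).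
Proof.
pose Mi i : 'M[{poly R}]_n := \matrix_(k, j) if k == i then (M k j)^`() else M k j.
have -> : (\det M)^`() = \sum_i \det (Mi i).
  rewrite /determinant raddf_sum/= exchange_big/=; apply: eq_bigr => s _.
  rewrite -mulr_sumr.
  have -> (b : bool) (q : {poly R}) : ((-1) ^+ b * q)^`() = (-1) ^+ b * q^`().
    by case: b; rewrite ?expr1 ?expr0 ?mulN1r ?mul1r ?derivN.
  congr (_ * _).
  rewrite deriv_prod ?index_enum_uniq//; apply: eq_bigr => i _.
  rewrite [RHS](bigD1 i)//= mxE eqxx; congr (_ * _).
  by apply: eq_bigr => j /negbTE ji; rewrite mxE ji.
apply: eq_bigr => i _; rewrite (expand_det_row _ i) mxE; apply: eq_bigr => j _.
rewrite !mxE eqxx; congr (_ * (_ * \det _)).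
by apply/matrixP => k l; rewrite !mxE eq_sym (negbTE (neq_lift _ _)).
Qed.

End DeterminantDerivative.

Section LogDeterminant.
Context {R : realType} {n : nat}.
Variable P : 'M[R]_n.

(** I - t P is treated as a matrix of polynomials in t, so that its derivative
and its adjugate are algebraic. *)
Let M : 'M[{poly R}]_n := 1%:M - 'X *: map_mx polyC P.

Let logtrace N : {poly R} := \sum_(k < N) (\tr (P ^+ k.+1) / k.+1%:R) *: 'X^(k.+1).

Let remainder N : {poly R} := \tr (map_mx polyC (P ^+ N.+1) *m \adj M).

(** Since (I - t P) adj (I - t P) = det (I - t P) I, the product det (I - t P)
tr P^(k+1) is the difference of two consecutive remainders; the sum telescopes
and its first term cancels the derivative of the determinant. *)
Let det_ode N :
  (\det M)^`() + \det M * (logtrace N)^`() = - ('X^N * remainder N).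
Proof.
have dlog : deriv (logtrace N) = \sum_(k < N) ('X^k * (\tr (P ^+ k.+1))%:P)%R.
  rewrite /logtrace raddf_sum/=; apply: eq_bigr => k _.
  rewrite derivZ derivXn /= -(scaler_nat _ 'X^k) scalerA divfK ?pnatr_eq0//.
  by rewrite mulrC mul_polyC.
have dM : (\det M)^`() = - remainder 0.
  have trN (A : 'M[{poly R}]_n) : - \tr A = \tr (- A) by rewrite raddfN.
  rewrite deriv_det /remainder expr1 trN -mulNmx; congr (\tr (_ *m _)).
  apply/matrixP => i j; rewrite !mxE derivB derivM derivX derivC mul1r mulr0 addr0.
  by case: eqP => _; rewrite ?mulr1n ?mulr0n ?derivC ?deriv0 sub0r.
have step k : \det M * (\tr (P ^+ k.+1))%:P = remainder k - 'X * remainder k.+1.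
  have trB (A B : 'M[{poly R}]_n) : \tr A - \tr B = \tr (A - B) by rewrite raddfB.
  rewrite -(trace_map_mx (polyC : {rmorphism R -> {poly R}})) -mxtraceZ -mul_mx_scalar.
  rewrite -mul_mx_adj mulmxA /remainder -mxtraceZ trB scalemxAl -mulmxBl.
  congr (\tr (_ *m _)); rewrite mulmxBr mulmx1 -scalemxAr; congr (_ - _ *: _).
  by rewrite [in RHS]exprSr -map_mxM.
rewrite dM dlog mulr_sumr.
under eq_bigr do rewrite mulrCA step mulrBr mulrA -exprSr.
rewrite -(big_mkord xpredT (fun k => 'X^k * remainder k - 'X^(k.+1) * remainder k.+1)).
rewrite (@telescope_sumr_eq _ 0 N (fun k => - ('X^k * remainder k)))//; last first.
  by move=> k _; rewrite opprK addrC.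
by rewrite expr0 mul1r opprK addrCA addNr addr0.
Qed.

Let norm_horner_le (q : {poly R}) (t : R) : 0 <= t <= 1 ->
  `|q.[t]| <= \sum_(k < size q) `|q`_k|.
Proof.
move=> /andP[t0 t1]; rewrite horner_coef (le_trans (ler_norm_sum _ _ _))//.
apply: ler_sum => k _; rewrite normrM ler_piMr// normrX ger0_norm//.
exact: exprn_ile1.
Qed.

Hypothesis P_ge0 : forall i j, 0 <= P i j.
Hypothesis P_summable : forall i j, cvgn (series (fun k => (P ^+ k) i j)).

Lemma expmx_ge0 k i j : 0 <= (P ^+ k) i j.
Proof.
elim: k i j => [|k IH] i j; first by rewrite expr0 !mxE; case: eqP.
by rewrite exprS mxE sumr_ge0// => l _; rewrite mulr_ge0.
Qed.

Let tr_ge0 k : 0 <= \tr (P ^+ k).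
Proof. by apply: sumr_ge0 => i _; exact: expmx_ge0. Qed.

Let S i : R := limn (series (fun k => (P ^+ k) i i)).

(** As tr P^(k+1) / (k + 1) <= tr P^(k+1), the diagonal of the Green's
function bounds the truncated logarithms. *)
Lemma logtrace_le N :
  \sum_(k < N) \tr (P ^+ k.+1) / k.+1%:R <= \sum_i S i.
Proof.
apply: (@le_trans _ _ (\sum_(k < N) \tr (P ^+ k.+1))).
  by apply: ler_sum => k _; rewrite ler_pdivrMr// ler_peMr// ler1n.
rewrite /mxtrace exchange_big/=; apply: ler_sum => i _.
apply: (@le_trans _ _ (series (fun k => (P ^+ k) i i) N.+1)).
  by rewrite /series/= big_mkord big_ord_recl lerDr expmx_ge0.
apply: nondecreasing_cvgn_le; last exact: P_summable.
by apply: nondecreasing_series => k _ _; exact: expmx_ge0.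
Qed.

Let D t : R := (\det M).[t].
Let B : R := \sum_i \sum_j \sum_(k < size (\adj M j i)) `|(\adj M j i)`_k|.

Let horner_det1 : D 1 = \det (1%:M - P).
Proof.
rewrite /D -horner_evalE -det_map_mx; congr (\det _); apply/matrixP => i j.
by rewrite /M !mxE rmorphB rmorphM rmorph_nat/= !horner_evalE hornerX hornerC mul1r.
Qed.

Let horner_det0 : D 0 = 1.
Proof.
rewrite /D -horner_evalE -det_map_mx -[RHS](det1 R n); congr (\det _).
apply/matrixP => i j.
by rewrite /M !mxE rmorphB rmorphM rmorph_nat/= !horner_evalE hornerX hornerC mul0r subr0.
Qed.

(** The bound is uniform in t on [0, 1] and tends to 0 with P^(N+1), because
the coefficients of the adjugate do not depend on N. *)
Let remainder_le N t : 0 <= t <= 1 ->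
  `|('X^N * remainder N).[t]| <= B * \sum_i \sum_j (P ^+ N.+1) i j.
Proof.
move=> t01; have /andP[t0 t1] := t01.
have adjB i j : `|(\adj M j i).[t]| <= B.
  apply: (le_trans (norm_horner_le _ t01)); rewrite /B (bigD1 i)//= (bigD1 j)//=.
  rewrite -addrA lerDl addr_ge0//; apply: sumr_ge0 => k _ //.
    exact: sumr_ge0.
  by apply: sumr_ge0 => l _; exact: sumr_ge0.
rewrite hornerM hornerXn normrM (@le_trans _ _ `|(remainder N).[t]|)//.
  by rewrite ler_piMl// normrX ger0_norm// exprn_ile1.
rewrite /remainder /mxtrace horner_sum mulr_sumr (le_trans (ler_norm_sum _ _ _))//.
apply: ler_sum => i _; rewrite mxE horner_sum mulr_sumr (le_trans (ler_norm_sum _ _ _))//.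
apply: ler_sum => j _; rewrite [map_mx _ _ _ _]mxE hornerM hornerC normrM [leLHS]mulrC.
by rewrite (ger0_norm (expmx_ge0 _ _ _)) ler_wpM2r ?expmx_ge0//.
Qed.

Let horner_logtrace N t : 0 <= t <= 1 -> (logtrace N).[t] <= \sum_i S i.
Proof.
move=> /andP[t0 t1]; apply: le_trans (logtrace_le N).
rewrite /logtrace horner_sum; apply: ler_sum => k _.
by rewrite hornerZ hornerXn ler_piMr ?divr_ge0// exprn_ile1.
Qed.

Let horner_logtrace1 N : (logtrace N).[1] = \sum_(k < N) \tr (P ^+ k.+1) / k.+1%:R.
Proof.
by rewrite /logtrace horner_sum; apply: eq_bigr => k _; rewrite hornerZ hornerXn expr1n mulr1.
Qed.

Let horner_logtrace0 N : (logtrace N).[0] = 0.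
Proof.
by rewrite /logtrace horner_sum big1// => k _; rewrite hornerZ hornerXn expr0n mulr0.
Qed.

(** Mean value theorem on [0, 1], applied to the product of det (I - t P) and
the exponential of the truncated logarithm. *)
Let det_expR_dist N :
  `|\det (1%:M - P) * expR (\sum_(k < N) \tr (P ^+ k.+1) / k.+1%:R) - 1| <=
  expR (\sum_i S i) * (B * \sum_i \sum_j (P ^+ N.+1) i j).
Proof.
pose u t : R := (\det M).[t] * expR (logtrace N).[t].
pose du t : R := (- ('X^N * remainder N)).[t] * expR (logtrace N).[t].
have udu (t : R) : is_derive t (1 : R) u (du t).
  apply: is_derive_eq; rewrite /du -det_ode hornerD hornerM /GRing.scale/=; ring.
have [|c c01] := @MVT_segment _ u du 0 1 ler01 (fun t _ => udu t).
  by apply: derivable_within_continuous => t _; exact: ex_derive.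
rewrite {1}/u -/(D 1) horner_det1 horner_logtrace1.
rewrite /u -/(D 0) horner_det0 horner_logtrace0 expR0 !mulr1.
rewrite subr0 mulr1 => ->; rewrite in_itv/= in c01.
rewrite /du hornerN normrM normrN mulrC ler_pM//.
  by rewrite ger0_norm ?expR_ge0// ler_expR horner_logtrace.
exact: remainder_le.
Qed.

(** The identity exp (tr log (I - P)) = det (I - P) without logarithms of
matrices or eigenvalues. Summability of the powers of P is what makes it hold
up to t = 1. *)
Lemma det_expR_trace :
  \det (1%:M - P) * expR (\sum_(k < N) \tr (P ^+ k.+1) / k.+1%:R) @[N --> \oo] --> (1 : R).
Proof.
have h : expR (\sum_i S i) * (B * \sum_i \sum_j (P ^+ N.+1) i j) @[N --> \oo] --> (0 : R).
  rewrite -[X in _ --> X](mulr0 (expR (\sum_i S i))); apply: cvgMl_tmp.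
  rewrite -[X in _ --> X](mulr0 B); apply: cvgMl_tmp.
  have cvg0_sum (f : 'I_n -> nat -> R) : (forall i, f i k @[k --> \oo] --> (0 : R)) ->
      \sum_i f i k @[k --> \oo] --> (0 : R).
    move=> f0; elim: (index_enum _) => [|i r IH].
      by under eq_cvg do rewrite big_nil; exact: cvg_cst.
    under eq_cvg do rewrite big_cons.
    by have := cvgD (f0 i) IH; rewrite addr0; exact.
  apply: (cvg0_sum) => i; apply: (cvg0_sum) => j.
  by rewrite (cvg_shiftS (fun N => (P ^+ N) i j)); exact: cvg_series_cvg_0.
apply/cvgrPdist_le => e e0; near=> N; rewrite distrC (le_trans (det_expR_dist N))//.
rewrite (le_trans (ler_norm _))// -[X in `|X|]subr0 distrC; near: N.
by move/cvgrPdist_le : h; exact.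
Unshelve. all: by end_near. Qed.

End LogDeterminant.

(** * Periods of words and rooted representatives of loops *)

Section Rotations.
Context {T : eqType}.
Implicit Types (s t : seq T) (x : T) (d e i j k : nat).

Lemma nth_rot_mod x0 k s i : (k <= size s)%N -> (i < size s)%N ->
  nth x0 (rot k s) i = nth x0 s ((i + k) %% size s).
Proof.
move=> ks si; rewrite /rot nth_cat size_drop nth_drop.
have [h|h] := ltnP i (size s - k).
  by rewrite modn_small addnC// -ltn_subRL.
have hk : (i - (size s - k) < k)%N by lia.
rewrite nth_take//; congr (nth _ _ _).
have -> : (i + k = (i - (size s - k)) + size s)%N by lia.
by rewrite modnDr modn_small//; lia.
Qed.

Lemma nth_flatten_nseq x0 t m i : (i < m * size t)%N ->
  nth x0 (flatten (nseq m t)) i = nth x0 t (i %% size t).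
Proof.
elim: m i => [|m IH] i //=; rewrite mulSn => im.
rewrite nth_cat; case: ltnP => h; first by rewrite modn_small.
rewrite IH; last by lia.
by congr (nth _ _ _); rewrite -[in RHS](subnK h) modnDr.
Qed.

Lemma size_flatten_nseq t m : size (flatten (nseq m t)) = (m * size t)%N.
Proof. by rewrite size_flatten /shape map_nseq sumn_nseq mulnC. Qed.

Lemma rot_muln_period s e m : rot e s = s -> (m * e <= size s)%N ->
  rot (m * e) s = s.
Proof.
move=> se; elim: m => [|m IH] ms; first by rewrite mul0n rot0.
by rewrite mulSn rotD -?mulSn// IH// (leq_trans _ ms)// leq_mul2r leqnSn orbT.
Qed.

Lemma rot_mod_period s e i : rot e s = s -> (i <= size s)%N ->
  rot i s = rot (i %% e) s.
Proof.
move=> se si; rewrite {1}(divn_eq i e) addnC rotD; last by rewrite addnC -divn_eq.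
by rewrite rot_muln_period// (leq_trans _ si)// leq_trunc_div.
Qed.

(** A word invariant under the rotation by a divisor e of its length is a
power of its prefix of length e; this is how periods produce concatenations of
equal loops. *)
Lemma rot_flatten_nseq s e : (0 < e)%N -> (e %| size s)%N -> rot e s = s ->
  s = flatten (nseq (size s %/ e) (take e s)).
Proof.
move=> e0 es se; case: s es se => [|x0 u]; first by rewrite /= div0n.
set s := x0 :: u => es se.
have ste : size (take e s) = e by rewrite size_takel// dvdn_leq.
apply: (@eq_from_nth _ x0) => [|i si].
  by rewrite size_flatten_nseq ste divnK.
rewrite nth_flatten_nseq ste ?divnK// nth_take ?ltn_mod//.
have ie : (i %/ e * e <= size s)%N by rewrite (leq_trans (leq_trunc_div _ _))// ltnW.
rewrite -{2}(rot_muln_period se ie) nth_rot_mod//; last first.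
  by rewrite (leq_ltn_trans (leq_mod _ _)).
by rewrite addnC -divn_eq modn_small.
Qed.

(** Rotating by the remainder of the length modulo the minimal period fixes s
too, so that this remainder is 0 by minimality. *)
Lemma min_period_dvdn s : (0 < size s)%N -> exists e,
  [/\ (0 < e)%N, (e %| size s)%N, rot e s = s &
      forall i, (0 < i)%N -> rot i s = s -> (e <= i)%N].
Proof.
move=> s0; have : exists e, (0 < e)%N && (rot e s == s).
  by exists (size s); rewrite s0 rot_size eqxx.
move=> /ex_minnP[e /andP[e0 /eqP se] emin].
have es : (e <= size s)%N by apply: emin; rewrite s0 rot_size eqxx.
exists e; split => //; last by move=> i i0 si; apply: emin; rewrite i0 si eqxx.
rewrite /dvdn; have [//|r0] := posnP (size s %% e).
have /emin : (0 < size s %% e)%N && (rot (size s %% e) s == s).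
  by rewrite r0 -rot_mod_period// rot_size eqxx.
by rewrite leqNgt ltn_mod e0.
Qed.

End Rotations.

Section LoopClasses.
Context {R : realType} {V : finType} {P : V -> V -> R}.
Implicit Types (g : uloop P) (u : rloop P).

Definition rooted_reps g : seq (seq V) :=
  undup [seq rot i (lseq g) | i <- iota 0 (size (lseq g))].

Lemma lseq_gt0 g : (0 < size (lseq g))%N.
Proof. by rewrite /lseq; case: (repr g) => -[]. Qed.

Lemma cycle_lseq g : cycle (edge P) (lseq g).
Proof. by rewrite /lseq; case: (repr g) => s /= /andP[]. Qed.

Lemma mem_rooted_reps g u : (val u \in rooted_reps g) = (\pi_(uloop P)%qT u == g).
Proof.
rewrite mem_undup; apply/mapP/eqP => [[i _ ui]|ug].
  rewrite -[RHS]reprK; apply/eqquotP; rewrite /= shift_equiv_sym.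
  by apply/shift_equivP; exists i.
have [k uk] := lseq_pi u; rewrite ug in uk.
have u0 := lseq_gt0 g; rewrite uk size_rot in u0.
have [k0|k0] := posnP k.
  exists 0%N; first by rewrite mem_iota/= lseq_gt0.
  by rewrite rot0 uk k0 rot0.
exists (size (val u) - k)%N; first by rewrite mem_iota/= add0n uk size_rot ltn_subrL k0.
by rewrite uk -(size_rot k) -/(rotr k _) rotK.
Qed.

Lemma rooted_reps_rloop g s : s \in rooted_reps g -> (s != [::]) && cycle (edge P) s.
Proof.
rewrite mem_undup => /mapP[i _ ->]; rewrite rot_cycle cycle_lseq andbT.
by rewrite -size_eq0 size_rot -lt0n lseq_gt0.
Qed.

Lemma size_rooted_reps g s : s \in rooted_reps g -> size s = size (lseq g).
Proof. by rewrite mem_undup => /mapP[i _ ->]; rewrite size_rot. Qed.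

(** The definition of the multiplicity only lets a loop t compete, repeated at
most as many times as the loop has steps. Both constraints hold automatically:
a nonempty word some repetition of which is a closed walk is itself one. *)
Lemma multiplicityP g : exists (s t : rloop P),
  [/\ \pi_(uloop P)%qT s = g, val s = flatten (nseq (multiplicity g) (val t)),
      (0 < multiplicity g)%N &
      forall (t' : seq V) j, val s = flatten (nseq j t') -> (j <= multiplicity g)%N].
Proof.
pose Q (j : 'I_(size (lseq g)).+1) : bool := `[< exists s t : rloop P,
              \pi_(uloop P)%qT s = g /\ val s = flatten (nseq j (val t)) >].
have [j Qj mj] : {j | Q j & multiplicity g = j}.
  apply: eq_bigmax_cond; apply/card_gt0P.
  exists (Ordinal (lseq_gt0 g : (1 < _.+1)%N)); rewrite inE.
  by exists (repr g), (repr g); rewrite reprK/= cats0.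
move: Qj => /asboolW[s [t [sg st]]].
have s0 : (0 < size (val s))%N.
  by have := lseq_gt0 (\pi_(uloop P)%qT s); have [k ->] := lseq_pi s; rewrite size_rot.
exists s, t; split => //; rewrite mj//.
  by case: (nat_of_ord j) st => // st; move: s0; rewrite st.
move=> t' i sti; rewrite -mj.
have [->//|i0] := posnP i.
have t'0 : t' != [::].
  by apply: contraPneq sti => ->; case: (val s) s0 => // ? ? _; elim: i {i0}.
have ct' : cycle (edge P) t'.
  move: s sg sti s0 {st} => [w /= /andP[_ cw]] _ wE _; move: cw; rewrite wE.
  case: t' t'0 {wE} => // y p _; case: i i0 => // i _.
  rewrite /= rcons_cat cat_path => /andP[yp h]; rewrite rcons_path yp /=.
  by move: h; case: i => [|i] /= /andP[].
have isz : (i < (size (lseq g)).+1)%N.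
  have [k] := lseq_pi s; rewrite sg => ->; rewrite size_rot sti size_flatten_nseq ltnS.
  by rewrite leq_pmulr// lt0n size_eq0.
have t'P : (t' != [::]) && cycle (edge P) t' by rewrite t'0.
have Qi : Q (Ordinal isz) by apply: asboolT; exists s, (exist _ t' t'P).
exact: (leq_bigmax_cond (F := fun j : 'I_(size (lseq g)).+1 => nat_of_ord j) _ Qi).
Qed.

(** The multiplicity J is the quotient of the length by the minimal period e,
and the representatives are the e distinct rotations. Those starting at x are
as numerous as the visits at x during one period, and the loop consists of J
periods. *)
Lemma count_rooted_reps g x :
  (multiplicity g * count (fun s => ohead s == Some x) (rooted_reps g))%N =
  visits g x.
Proof.
have [s [t [sg st J0 Jmax]]] := multiplicityP g.
set J := multiplicity g in st J0 Jmax *.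
have s0 : (0 < size (val s))%N.
  by have := lseq_gt0 (\pi_(uloop P)%qT s); have [k ->] := lseq_pi s; rewrite size_rot.
have [e [e0 es se emin]] := min_period_dvdn s0.
have et : e = size (val t).
  have sJ : size (val s) = (J * size (val t))%N by rewrite st size_flatten_nseq.
  (* maximality of J and minimality of e give the two inequalities *)
  have := Jmax _ _ (rot_flatten_nseq e0 es se).
  rewrite leq_divLR// sJ leq_pmul2l// => te; apply/eqP; rewrite eqn_leq te andbT.
  apply: emin; first by move: s0; rewrite sJ muln_gt0 => /andP[].
  rewrite st; case: (J) J0 => // m _ /=; rewrite rot_size_cat.
  elim: m => [|m IH] /=; first by rewrite cats0.
  by rewrite -catA IH.
rewrite -[in RHS]sg visits_pi st count_flatten map_nseq sumn_nseq [RHS]mulnC; congr (_ * _)%N.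
have /permP -> : perm_eq (rooted_reps g) [seq rot i (val s) | i <- iota 0 e].
  apply: uniq_perm; first exact: undup_uniq.
    rewrite map_inj_in_uniq ?iota_uniq// => i j; rewrite !mem_iota/= !add0n => ie je.
    wlog ij : i j ie je / (i <= j)%N => [hw|ijE].
      by case: (leqP i j) => [|/ltnW] ij h; [|symmetry]; apply: hw => //; exact: esym.
    apply/eqP; rewrite eqn_leq ij/= leqNgt -subn_gt0; apply/negP => ji0.
    have : rot (j - i) (val s) = val s.
      apply: (@rot_inj i); rewrite ijE -rotD subnKC//.
      by rewrite (leq_trans (ltnW je))// dvdn_leq.
    by move=> /(emin _ ji0); lia.
  move=> w; apply/idP/mapP => [wg|[i]].
    have wP := rooted_reps_rloop wg; pose u : rloop P := exist _ w wP.
    have := mem_rooted_reps g u; rewrite [val u]/= wg -sg => /esym/eqP/esym/eqquotP.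
    move=> /shift_equivP[k]; rewrite [val u]/= => ->.
    have [ks|sk] := leqP k (size (val s)).
      by exists (k %% e)%N; [rewrite mem_iota/= ltn_mod|rewrite -rot_mod_period].
    by exists 0%N; [rewrite mem_iota|rewrite rot0 rot_oversize// ltnW].
  rewrite mem_iota/= add0n => ie ->.
  have wP : (rot i (val s) != [::]) && cycle (edge P) (rot i (val s)).
    rewrite rot_cycle -size_eq0 size_rot -lt0n s0/=.
    by case: (s) => ? /= /andP[].
  pose u : rloop P := exist (fun w : seq V => (w != [::]) && cycle (edge P) w) _ wP.
  rewrite -[rot i _]/(val u) mem_rooted_reps -sg; apply/eqP/esym/eqquotP.
  by apply/shift_equivP; exists i.
rewrite count_map -[in RHS](mkseq_nth x (val t)) /mkseq count_map -et.
apply: eq_in_count => i; rewrite mem_iota/= add0n => ie.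
have is_ : (i < size (val s))%N by rewrite (leq_trans ie)// dvdn_leq.
rewrite /= (_ : ohead (rot i (val s)) = Some (nth x (val t) i))//.
rewrite /rot (drop_nth x)//=; congr Some.
rewrite st nth_flatten_nseq -?et ?modn_small//.
by rewrite (leq_trans ie)// leq_pmull.
Qed.

End LoopClasses.

(** * Sums over loops as sums over closed walks *)

Section Words.
Context {V : finType}.

Fixpoint words (l : nat) : seq (seq V) :=
  if l is l'.+1 then [seq x :: s | x <- enum V, s <- words l'] else [:: [::]].

Lemma mem_words l (s : seq V) : (s \in words l) = (size s == l).
Proof.
elim: l s => [|l IH] s /=; first by rewrite inE size_eq0.
apply/allpairsP/idP => [[[x t] /= [_ + ->]]|]; first by rewrite IH.
case: s => // x s; rewrite /= eqSS -IH => sl; exists (x, s); split => //=.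
by rewrite mem_enum.
Qed.

Lemma uniq_words l : uniq (words l).
Proof.
elim: l => [|l IH] //=; apply: allpairs_uniq => //; first exact: enum_uniq.
by move=> [x s] [y t] _ _ /= [-> ->].
Qed.

Lemma big_words_cons (R : nmodType) l (Q : pred (seq V)) (F : seq V -> R) :
  \sum_(s <- words l.+1 | Q s) F s =
  \sum_x \sum_(s <- words l | Q (x :: s)) F (x :: s).
Proof.
rewrite /= big_mkcond big_allpairs_dep/= big_enum/=.
by apply: eq_bigr => x _; rewrite -big_mkcond.
Qed.

End Words.
Arguments words : simpl never.

Section LoopSums.
Context {R : realType} {V : finType} {P : V -> V -> R}.
Implicit Types (g : uloop P) (s : seq V).

Definition loop_of s : option (uloop P) :=
  omap (fun u : rloop P => \pi_(uloop P)%qT u) (insub s).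

(** As loops may be arbitrarily long, sums over loops of bounded length range
over an explicit list. *)
Definition loops_le K : seq (uloop P) :=
  undup (flatten [seq pmap loop_of (words l) | l <- iota 0 K.+1]).

Lemma mem_loops_le K g : (g \in loops_le K) = (size (lseq g) <= K)%N.
Proof.
rewrite mem_undup; apply/flatten_mapP/idP => [[l]|gK].
  rewrite mem_iota/= add0n mem_pmap ltnS => lK /mapP[s].
  rewrite mem_words /loop_of => /eqP sl; case: insubP => //= u _ us [->].
  by have [k ->] := lseq_pi u; rewrite size_rot (us : val u = s) sl.
exists (size (lseq g)); first by rewrite mem_iota/= ltnS.
rewrite mem_pmap; apply/mapP; exists (lseq g); first by rewrite mem_words.
by rewrite /loop_of /lseq valK/= reprK.
Qed.

(** F takes a single value on the representatives of a loop, and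
count_rooted_reps tells how many of them start at x. *)
Lemma big_rooted_reps g l (x : V) (F : seq V -> R) : size (lseq g) = l ->
  (forall s i, F (rot i s) = F s) ->
  \sum_(s <- words l | (s \in rooted_reps g) && (ohead s == Some x)) F s =
  (multiplicity g)%:R^-1 * (visits g x)%:R * F (lseq g).
Proof.
move=> gl Frot.
have [_ [_ [_ _ J0 _]]] := multiplicityP g.
rewrite -big_filter_cond.
rewrite (perm_big (rooted_reps g)); last first.
  apply: uniq_perm; rewrite ?filter_uniq ?uniq_words ?undup_uniq// => s.
  rewrite mem_filter mem_words andb_idr// => /size_rooted_reps ->.
  exact/eqP.
rewrite -(count_rooted_reps g x) natrM mulKf ?pnatr_eq0 -?lt0n//.
rewrite -sum1_count natr_sum mulr_suml big_seq_cond [RHS]big_seq_cond.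
apply: eq_bigr => s /andP[+ _]; rewrite mem_undup => /mapP[i _ ->].
by rewrite Frot mul1r.
Qed.

(** Each closed walk starting at x is a rooted representative of exactly one
loop; summing over the walks first and over the loops first gives the two
sides. The walk x :: s has between 1 and K steps, so s has fewer than K
vertices. *)
Lemma sum_loops K (x : V) (F : seq V -> R) : (forall s i, F (rot i s) = F s) ->
  \sum_(g <- loops_le K) (multiplicity g)%:R^-1 * (visits g x)%:R * F (lseq g) =
  \sum_(l < K) \sum_(s <- words l | path (edge P) x (rcons s x)) F (x :: s).
Proof.
move=> Frot.
transitivity (\sum_(g <- loops_le K) \sum_(l < K)
   \sum_(s <- words l.+1 | (s \in rooted_reps g) && (ohead s == Some x)) F s).
  rewrite big_seq [RHS]big_seq; apply: eq_bigr => g; rewrite mem_loops_le => gK.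
  have g0 := lseq_gt0 g.
  have lK : ((size (lseq g)).-1 < K)%N by rewrite prednK.
  rewrite (bigD1 (Ordinal lK))//= [X in _ + X]big1 ?addr0 => [|l lg].
    by rewrite (big_rooted_reps _ _ Frot)// prednK.
  rewrite big_seq_cond big1// => s /andP[+ /andP[/size_rooted_reps + _]].
  rewrite mem_words => /eqP -> lE.
  by move: lg; rewrite -val_eqE/= -lE eqxx.
rewrite exchange_big/=; apply: eq_bigr => l _.
transitivity (\sum_(s <- words l.+1 | cycle (edge P) s && (ohead s == Some x)) F s).
  rewrite (exchange_big_dep (fun s => cycle (edge P) s && (ohead s == Some x)))/=; last first.
    by move=> g s _ /andP[/rooted_reps_rloop/andP[_ ->] ->].
  rewrite big_seq_cond [RHS]big_seq_cond; apply: eq_bigr => s /andP[+ /andP[cs sx]].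
  rewrite mem_words => /eqP sl.
  have sP : (s != [::]) && cycle (edge P) s by rewrite cs andbT; case: (s) sl.
  pose u : rloop P := exist (fun w : seq V => (w != [::]) && cycle (edge P) w) _ sP.
  have uK : \pi_(uloop P)%qT u \in loops_le K.
    by rewrite mem_loops_le; have [k ->] := lseq_pi u; rewrite size_rot/= sl.
  rewrite (eq_bigl (fun g => g == \pi_(uloop P)%qT u)); last first.
    by move=> g; rewrite sx andbT eq_sym -mem_rooted_reps.
  rewrite big_mkcond (bigD1_seq _ uK) ?undup_uniq//= eqxx big1 ?addr0// => g.
  by move=> /negbTE ->.
rewrite big_words_cons (bigD1 x)//= [X in _ + X]big1 ?addr0 => [|y yx].
  by under eq_bigl do rewrite eqxx andbT.
by rewrite big1// => s /andP[_]; move: yx => /negbTE yx /eqP[yE]; rewrite yE eqxx in yx.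
Qed.

End LoopSums.

(** * Coefficients of an exponential in several variables *)

Section ExponentialCoefficients.
Context {R : realFieldType} {I E : finType}.
Variables (a : I -> R) (c : I -> E -> nat) (K : nat).
Implicit Types (n : {ffun E -> nat}) (k : {ffun I -> 'I_K.+1}).

Definition total_is n : pred {ffun I -> 'I_K.+1} :=
  fun k => [forall e, (\sum_i k i * c i e)%N == n e].

(** The coefficient of z^n in the exponential of sum_i a_i z^(c_i). Bounding
the multiplicities by K makes the sum finite and loses nothing as long as
sum_e n e <= K and no c_i vanishes, by total_is_lt. *)
Definition exp_coef n : R :=
  \sum_(k | total_is n k) \prod_i (a i ^+ k i / (k i)`!%:R).

Hypothesis c_gt0 : forall i, (0 < \sum_e c i e)%N.

Lemma total_is_lt n k i : total_is n k -> (k i <= \sum_e n e)%N.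
Proof.
move=> /forallP nk; apply: (@leq_trans (\sum_e k i * c i e)).
  by rewrite -big_distrr/= leq_pmulr.
by apply: leq_sum => e _; rewrite -(eqP (nk e)) (bigD1 i)//= leq_addr.
Qed.

(** Taking one copy of i away from k turns k_i / k_i! into 1 / (k_i - 1)! and
n into n - c_i; the map is a bijection from the multiplicities with k_i >
0. *)
Let exp_coef_pull n i : (\sum_e n e <= K)%N ->
  \sum_(k | total_is n k) (k i)%:R * \prod_j (a j ^+ k j / (k j)`!%:R) =
  a i * if [forall e, (c i e <= n e)%N] then exp_coef [ffun e => (n e - c i e)%N] else 0.
Proof.
move=> nK; rewrite (bigID (fun k => (0 < k i)%N))/= [X in _ + X]big1 ?addr0; last first.
  by move=> k /andP[_]; rewrite -eqn0Ngt => /eqP ->; rewrite mul0r.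
case: ifPn => [/forallP cn|/forallPn/=[e]]; last first.
  rewrite -ltnNge => ne; rewrite mulr0 big1// => k /andP[/forallP/(_ e)/eqP nk ki].
  suff : (c i e <= n e)%N by rewrite leqNgt ne.
  by rewrite -nk (bigD1 i)//= (leq_trans _ (leq_addr _ _))// leq_pmull.
set n' := [ffun e => _]; rewrite mulr_sumr.
pose up k : {ffun I -> 'I_K.+1} := [ffun j => inord (k j + (j == i))].
pose down k : {ffun I -> 'I_K.+1} := [ffun j => inord (k j - (j == i))].
have n'lt : (\sum_e n' e < K)%N.
  apply: leq_trans nK; have : (\sum_e n' e + \sum_e c i e = \sum_e n e)%N.
    by rewrite -big_split/=; apply: eq_bigr => e _; rewrite ffunE subnK.
  by move=> <-; rewrite -addn1 leq_add2l.
have upE k j : (k i < K)%N -> up k j = (k j + (j == i))%N :> nat.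
  move=> ki; rewrite ffunE inordK//; have [->|_] := eqVneq; first by rewrite addn1.
  by rewrite addn0.
have total_up k : (k i < K)%N -> total_is n (up k) = total_is n' k.
  move=> ki; apply: eq_forallb => e; rewrite ffunE.
  have -> : (\sum_j up k j * c j e = \sum_j k j * c j e + c i e)%N.
    rewrite (bigD1 i)//= upE// eqxx [in RHS](bigD1 i)//= addn1 mulSn.
    rewrite -addnA addnC; congr (_ + _ + _)%N.
    by apply: eq_bigr => j /negbTE ji; rewrite upE// ji addn0.
  by rewrite -(eqn_add2r (c i e) _ (n e - c i e)) subnK.
rewrite (reindex_onto up down) => [|k /andP[_ ki]]; last first.
  apply/ffunP => j; apply/ord_inj; rewrite !ffunE.
  have [->|ji] := eqVneq j i; last by rewrite addn0 subn0 !inord_val.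
  have kiE : nat_of_ord (inord (k i - 1) : 'I_K.+1) = (k i).-1.
    by rewrite subn1 inordK// (leq_ltn_trans (leq_pred _)).
  by rewrite addn1 kiE prednK// inord_val.
have condE k : [&& total_is n (up k) && (0 < up k i)%N & down (up k) == k] = total_is n' k.
  have [kiK|Kki] := ltnP (k i) K.
    rewrite total_up// upE// eqxx addn1/= andbT andb_idr// => _.
    apply/eqP/ffunP => j; apply/ord_inj; rewrite [down _ j]ffunE upE// addnK inord_val//.
  (* inord saturates if k i = K, so up k i = 0, and such a k is too large for n' *)
  rewrite [RHS](contraTF _ (leqnn K))//; last first.
    move=> /(total_is_lt i) ki; rewrite -ltnNge.
    by rewrite (leq_ltn_trans Kki)// (leq_ltn_trans ki).
  have kK : (k i = K :> nat) by apply/eqP; rewrite eqn_leq Kki -ltnS ltn_ord.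
  rewrite [up k i]ffunE eqxx addn1 kK /inord /insubd insubF ?ltnn//=.
  by rewrite andbF.
rewrite (eq_bigl _ _ condE); apply: eq_bigr => k kn'.
have kiK : (k i < K)%N by rewrite (leq_ltn_trans (total_is_lt i kn')).
rewrite (bigD1 i)//= [in RHS](bigD1 i)//= !upE// eqxx addn1 !mulrA; congr (_ * _).
  rewrite exprS factS natrM.
  have k1 : (k i).+1%:R != 0 :> R by rewrite pnatr_eq0.
  have kf : (k i)`!%:R != 0 :> R by rewrite pnatr_eq0 -lt0n fact_gt0.
  by move: (k i).+1%:R (k i)`!%:R (a i ^+ k i) k1 kf => u v w u0 v0; field; apply/andP.
by apply: eq_bigr => j /negbTE ji; rewrite !upE// ji addn0.
Qed.

(** An Euler operator, multiplying the coefficient of z^n by the part of the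
degree in S, is a derivation: the derivative of exp f is f' exp f. *)
Lemma exp_coef_deriv (S : pred E) n : (\sum_e n e <= K)%N ->
  (\sum_(e | S e) n e)%:R * exp_coef n =
  \sum_i a i * (\sum_(e | S e) c i e)%:R *
    if [forall e, (c i e <= n e)%N] then exp_coef [ffun e => (n e - c i e)%N] else 0.
Proof.
move=> nK.
transitivity (\sum_i (\sum_(e | S e) c i e)%:R *
    \sum_(k | total_is n k) (k i)%:R * \prod_j (a j ^+ k j / (k j)`!%:R)).
  under [RHS]eq_bigr do rewrite mulr_sumr.
  rewrite exchange_big/= mulr_sumr; apply: eq_bigr => k /forallP nk.
  under [RHS]eq_bigr do rewrite mulrA.
  rewrite -mulr_suml; congr (_ * _).
  under [RHS]eq_bigr do rewrite -natrM.
  rewrite -natr_sum; congr _%:R.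
  under [RHS]eq_bigr do rewrite mulnC big_distrr/=.
  by rewrite exchange_big/=; apply: eq_bigr => e _; exact/esym/eqP.
by apply: eq_bigr => i _; rewrite exp_coef_pull// mulrCA mulrA.
Qed.

Lemma exp_coef0 : exp_coef [ffun=> 0%N] = 1.
Proof.
rewrite /exp_coef (big_pred1 [ffun=> ord0]) => [|k].
  by rewrite big1// => i _; rewrite ffunE expr0 divr1.
apply/idP/eqP => [k0|->]; last first.
  by apply/forallP => e; rewrite ffunE big1// => i _; rewrite ffunE.
apply/ffunP => i; apply/ord_inj; rewrite ffunE/=; apply/eqP.
by rewrite -leqn0 (leq_trans (total_is_lt i k0))// big1// => e _; rewrite ffunE.
Qed.

End ExponentialCoefficients.

(** * Simple paths in a *-forest *)

Section Forests.
Context {V : finType} (e : rel V).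
Hypothesis e_sym : symmetric e.
Hypothesis e_forest : forall s : seq V, ucycle e s -> (size s <= 2)%N.
Implicit Types (a b x y : V) (p q : seq V).

(** Otherwise the edge from a to b and the part of the path from a to b would
form a cycle with at least three vertices. This is the form in which
acyclicity is used throughout. *)
Lemma mem_path_head a b p : path e a p -> uniq (a :: p) -> e a b -> b != a ->
  b \in p -> exists p', p = b :: p'.
Proof.
move=> ap up eab ba bp; case/splitPr: bp ap up => p1 p2.
rewrite cat_path => /andP[ap1]; rewrite [path e _ (b :: _)]/= => /andP[p1b _] up.
suff : size p1 = 0%N by move=> /size0nil ->; exists p2.
have /e_forest : ucycle e (a :: rcons p1 b).
  rewrite /ucycle/= !rcons_path ap1 p1b last_rcons e_sym eab/=.
  move: up; rewrite -cat_rcons -cat_cons cat_uniq => /andP[+ _].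
  by rewrite /= rcons_uniq.
by rewrite /= size_rcons; case: size.
Qed.

(** Following r from an edge, never turning back, draws a path which stays
simple by mem_path_head, hence eventually has more vertices than V.  *)
Lemma dead_end_free_rel (r : rel V) : subrel r e ->
  (forall u v, u != v -> r u v -> exists w, [/\ w != u, w != v & r v w]) ->
  forall u v, u != v -> ~~ r u v.
Proof.
move=> re rext u v uv; apply/negP => ruv.
(* the path is stored backwards, its most recent vertex b in front *)
have long l : exists b a p, [/\ size p = l, uniq (b :: a :: p),
    path e b (a :: p) & r a b].
  elim: l => [|l [b [a [p [pl ubap bap rab]]]]].
    exists v, u, [::]; split => //=; last by rewrite e_sym re.
    by rewrite inE eq_sym uv.
  have ba : a != b by move: ubap; rewrite /= inE negb_or eq_sym => /andP[/andP[]].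
  have [w [wa wb rbw]] := rext _ _ ba rab.
  exists w, b, (a :: p); split => //; first by rewrite /= pl.
    rewrite cons_uniq ubap andbT inE (negbTE wb)/=; apply/negP => wap.
    have [p' [wE _]] := mem_path_head bap ubap (re _ _ rbw) wb wap.
    by rewrite wE eqxx in wa.
  by rewrite [path _ _ _]/= e_sym re.
(* a path with #|V| + 2 distinct vertices *)
have [b [a [p [pl + _ _]]]] := long #|V|.
move=> /card_uniqP card; have : (size (b :: a :: p) <= #|V|)%N.
  by rewrite -card; exact: max_card.
by rewrite /= pl => /ltnW; rewrite ltnn.
Qed.

(** Two simple paths leaving b by different edges never meet again. Moving b
along q lengthens the first path at its head, and mem_path_head forbids a
return to it. *)
Lemma simple_path_avoid q b a p : uniq (b :: a :: p) -> path e b (a :: p) ->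
  path e b q -> uniq (a :: b :: q) -> last b q \notin a :: p.
Proof.
elim: q b a p => [|w q IH] b a p ubap bap; first by move: ubap => /andP[].
move=> /=/andP[ebw wq] /andP[]; rewrite !inE !negb_or => /and3P[ab aw aq].
move=> /andP[/andP[bw bq] /andP[wnq uq]].
have uw : uniq (w :: b :: a :: p).
  rewrite cons_uniq ubap andbT inE eq_sym (negbTE bw)/=; apply/negP => wap.
  have [|p' [wE _]] := mem_path_head bap ubap ebw _ wap; first by rewrite eq_sym.
  by rewrite wE eqxx in aw.
have uw' : uniq (b :: w :: q) by rewrite /= inE negb_or bw bq wnq uq.
have := IH w b (a :: p) uw _ wq uw'; rewrite [path _ _ _]/= e_sym ebw => /(_ bap).
by rewrite !inE !negb_or => /andP[_].
Qed.

(** Two simple paths with the same ends which split at some vertex would meet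
again, against simple_path_avoid. *)
Lemma simple_path_inj x p q : path e x p -> path e x q -> uniq (x :: p) ->
  uniq (x :: q) -> last x p = last x q -> p = q.
Proof.
have last_nil y s : uniq (y :: s) -> last y s = y -> s = [::].
  by case: s => //= z s /andP[/negP yzs _] yE; case: yzs; rewrite -yE mem_last.
elim: p x q => [|y p IH] x [|z q] //; first by move=> _ _ _ /last_nil h /esym/h.
  by move=> _ _ /last_nil h _ /h.
have [<-|yz] := eqVneq y z.
  by move=> /andP[_ yp] /andP[_ yq] /andP[_ up] /andP[_ uq] /= h; congr cons; exact: IH h.
move=> xyp /andP[exz zq] uxyp uxzq lE; exfalso.
have xz : z != x.
  by move: uxzq; rewrite /= inE negb_or eq_sym => /andP[/andP[]].
have uz : uniq (z :: x :: y :: p).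
  rewrite cons_uniq uxyp andbT inE (negbTE xz)/=; apply/negP => zyp.
  by have [p' [yE _]] := mem_path_head xyp uxyp exz xz zyp; rewrite yE eqxx in yz.
have := simple_path_avoid uz _ zq uxzq; rewrite [path _ _ _]/= e_sym exz => /(_ xyp).
by move: lE => /= <-; rewrite inE mem_last orbT.
Qed.

Lemma simple_path_root x : exists p,
  [/\ path e x p, uniq (x :: p) & last x p = fingraph.root e x].
Proof.
by have /connectP[p xp ->] := connect_root e x; case: (shortenP xp) => p' ? ? _; exists p'.
Qed.

(** The representative of the edge {u, v} chosen in oedges. *)
Definition oedge u v : V * V :=
  if (enum_rank u <= enum_rank v)%N then (u, v) else (v, u).

Lemma oedgeC u v : oedge u v = oedge v u.
Proof.
rewrite /oedge; case: ltngtP => // /ord_inj/enum_rank_inj ->//.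
Qed.

Lemma oedge_inj u v u' v' : oedge u v = oedge u' v' ->
  (u = u' /\ v = v') \/ (u = v' /\ v = u').
Proof. by rewrite /oedge; do 2!case: ifP => _; case=> -> ->; [left|right|right|left]. Qed.

(** Rooting every component, each vertex other than the roots is sent to the
edge which leads from it towards its root, and this is a bijection onto the
edges other than self-loops. The roots count the components. *)
Lemma card_nonloop_edges :
  (#|[pred uv : V * V | [&& e uv.1 uv.2, (enum_rank uv.1 <= enum_rank uv.2)%N &
       uv.1 != uv.2]]| + n_comp e V = #|V|)%N.
Proof.
pose nonroot := finset (fun x => fingraph.root e x != x).
have csym := sym_connect_sym e_sym.
have -> : (n_comp e V = #|~: nonroot|)%N.
  by apply: eq_card => x; rewrite !inE andbT negbK.
rewrite -[RHS](cardsC nonroot); congr (_ + _)%N.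
have par x : exists w, x \in nonroot -> exists p,
    [/\ path e x (w :: p), uniq (x :: w :: p) & last w p = fingraph.root e x].
  have [[|w p] [xp up xr]] := simple_path_root x; last by exists w => _; exists p.
  by exists x; rewrite inE -xr eqxx.
have [{}par parP] := choice par.
have rootE x y : e x y -> fingraph.root e x = fingraph.root e y.
  by move=> exy; apply/eqP; rewrite root_connect// connect1.
rewrite -[RHS](@card_in_imset _ _ (fun x => oedge x (par x))); last first.
  (* u and v cannot each be the next vertex of the other towards the root *)
  move=> u v un vn /oedge_inj[[]//|[uE vE]]; exfalso.
  have [p [pu uu ru]] := parP _ un; have [q [qv uv rv]] := parP _ vn.
  rewrite vE in pu uu ru; rewrite -uE in qv uv rv.
  have euv : e u v by move: pu => /andP[].
  have uq : path e u q by move: qv => /andP[].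
  have /andP[vuq uuq] := uv.
  have : v :: p = q.
    apply: (simple_path_inj pu uq uu uuq); rewrite /= ru rv; exact: rootE.
  by move=> qE; move: vuq; rewrite -qE !inE eqxx orbT.
apply: eq_card => -[u v]; rewrite !inE/=; apply/and3P/imsetP => [[euv ruv uv]|[x xn]].
  have oE : oedge u v = (u, v) by rewrite /oedge ruv.
  have [p [up uup ur]] := simple_path_root u.
  (* of u and v, the one farther from the root is the preimage *)
  have [vp|vp] := boolP (v \in p).
    have [|p' pE] := mem_path_head up uup euv _ vp; first by rewrite eq_sym.
    have un : u \in nonroot.
      rewrite inE -ur pE /=; apply: contraTneq uup => <-.
      by rewrite pE cons_uniq mem_last.
    exists u => //; rewrite -oE; congr oedge.
    have [q [uq uuq uqr]] := parP _ un.
    have : p = par u :: q by apply: simple_path_inj up uq uup uuq _; rewrite ur /= uqr.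
    by rewrite pE => -[].
  have uvp : uniq (v :: u :: p) by rewrite cons_uniq uup andbT inE negb_or eq_sym uv.
  have vpath : path e v (u :: p) by rewrite /= e_sym euv.
  have vr : last u p = fingraph.root e v by rewrite ur; exact: rootE.
  have vn : v \in nonroot.
    rewrite inE -vr; apply: contraTneq uvp => {1}<-.
    by rewrite cons_uniq mem_last.
  exists v => //; rewrite -oE oedgeC; congr oedge.
  have [q [vq uvq vqr]] := parP _ vn.
  have : u :: p = par v :: q by apply: simple_path_inj vpath vq uvp uvq _; rewrite /= vr vqr.
  by case.
have [p [px ux _]] := parP _ xn.
have exw : e x (par x) by move: px => /andP[].
have xw : x != par x by move: ux; rewrite /= inE negb_or => /andP[/andP[]].
rewrite /oedge; case: ifPn => [h [-> ->]//|]; rewrite -ltnNge => h [-> ->].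
by rewrite e_sym eq_sym ltnW.
Qed.

End Forests.

(** * Flows balanced up to a simple path *)

Section DecrementCount.
Context {V : finType}.
Implicit Types (n : {ffun V * V -> nat}) (a b u v x : V) (p : seq V).

Definition outdeg n x : nat := (\sum_y n (x, y))%N.

Definition decr n a b : {ffun V * V -> nat} :=
  [ffun uv => (n uv - (uv == (a, b)))%N].

Lemma decrK n a b uv : (0 < n (a, b))%N ->
  n uv = (decr n a b uv + (uv == (a, b)))%N.
Proof. by rewrite ffunE => nab; case: eqP => [->|_]; rewrite ?subnK ?subn0 ?addn0. Qed.

Lemma outdeg_decr n a b v : (0 < n (a, b))%N ->
  outdeg n v = (outdeg (decr n a b) v + (v == a))%N.
Proof.
move=> nab; rewrite /outdeg.
under eq_bigr do rewrite (decrK _ nab).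
rewrite big_split/=; congr (_ + _)%N.
under eq_bigr do rewrite xpair_eqE.
case: (v == a) => /=; last by rewrite big1.
by rewrite (bigD1 b)//= eqxx big1// => y /negbTE ->.
Qed.

Definition path_steps a p : seq (V * V) := zip (a :: p) p.

Lemma mem_path_steps a p u v : (u, v) \in path_steps a p -> u \in a :: p /\ v \in p.
Proof.
elim: p a => // b p IH a; rewrite /path_steps/= inE => /orP[/eqP[-> ->]|].
  by rewrite !inE !eqxx.
by move=> /IH[ubp vp]; rewrite !inE in ubp *; rewrite vp !orbT ubp orbT.
Qed.

(** The shape of the crossings left to be made by a walk which is now at a and
has to end at x, p being the simple path from a to x: the crossings still to
be used along p outnumber by one those in the opposite direction, and all
other edges are balanced. *)
Definition flow_along n a p : Prop := forall u v,
  (n (u, v) + ((v, u) \in path_steps a p) =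
   n (v, u) + ((u, v) \in path_steps a p))%N.

(** Hence at the current vertex the imbalance singles out the first step of
p. *)
Lemma flow_along_head n a p b : uniq (a :: p) -> flow_along n a p ->
  n (a, b) = (n (b, a) + (ohead p == Some b))%N.
Proof.
move=> uap /(_ a b).
have -> : (b, a) \in path_steps a p = false.
  by apply/negP => /mem_path_steps[_ ap]; move: uap; rewrite /= ap.
rewrite addn0 => ->; congr (_ + _)%N; congr nat_of_bool.
case: p uap => // c p /= /andP[acp _]; rewrite inE xpair_eqE eqxx/=.
rewrite [RHS](_ : _ = (b == c)); last by rewrite eq_sym.
case: eqVneq => //= _; apply/negP => /mem_path_steps[acp' _].
by rewrite acp' in acp.
Qed.

(** A step along a self-loop keeps the path back to x, a step along the path
removes its head, and any other step adds the vertex just left to it. In a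
*-forest there are no further cases, by mem_path_head. *)
Lemma flow_along_decr (e : rel V) n a p b x : symmetric e ->
  (forall s : seq V, ucycle e s -> (size s <= 2)%N) ->
  path e a p -> uniq (a :: p) -> last a p = x -> flow_along n a p ->
  e a b -> (0 < n (a, b))%N ->
  exists q, [/\ path e b q, uniq (b :: q), last b q = x &
    flow_along (decr n a b) b q].
Proof.
move=> es ef ap uap lx nap eab nab.
have [ba|ba] := eqVneq b a.
  exists p; rewrite ba; split => // u v; have := nap u v.
  rewrite (decrK (u, v) nab) (decrK (v, u) nab) ba !xpair_eqE [(u == a) && _]andbC.
  by lia.
have [bp|bp] := boolP (b \in p).
  have [q pE] := mem_path_head es ef ap uap eab ba bp; rewrite pE in ap uap lx nap.
  exists q; split => //=; [by move: ap => /andP[]|by move: uap => /andP[]|].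
  move=> u v; have := nap u v.
  have stepE u' v' : ((u', v') \in path_steps a (b :: q)) =
     (((u', v') == (a, b)) + ((u', v') \in path_steps b q))%N :> nat.
    rewrite /path_steps/= inE; case: eqP => //= -[-> _].
    have -> // : (a, v') \in zip (b :: q) q = false.
    by apply/negP => /mem_path_steps[abq _]; move: uap; rewrite /= abq.
  rewrite !stepE (decrK (u, v) nab) (decrK (v, u) nab).
  by move: (decr n a b (u, v)) (decr n a b (v, u)) (nat_of_bool ((u, v) == (a, b)))
    (nat_of_bool ((v, u) == (a, b))) (nat_of_bool (_ \in _)) (nat_of_bool (_ \in _)) => *; lia.
exists (a :: p); split => //.
- by rewrite /= es eab.
- by rewrite cons_uniq uap andbT inE negb_or ba.
move=> u v; have := nap u v.
have stepE u' v' : ((u', v') \in path_steps b (a :: p)) =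
   (((v', u') == (a, b)) + ((u', v') \in path_steps a p))%N :> nat.
  rewrite /path_steps/= inE xpair_eqE andbC -xpair_eqE; case: eqP => //= -[-> ->].
  have -> // : (b, a) \in zip (a :: p) p = false.
  by apply/negP => /mem_path_steps[_ pa]; move: uap; rewrite /= pa.
rewrite !stepE (decrK (u, v) nab) (decrK (v, u) nab).
by move: (decr n a b (u, v)) (decr n a b (v, u)) (nat_of_bool ((u, v) == (a, b)))
    (nat_of_bool ((v, u) == (a, b))) (nat_of_bool (_ \in _)) (nat_of_bool (_ \in _)) => *; lia.
Qed.

End DecrementCount.

(** * The density and its first-step equation *)

Section FieldDensity.
Context {R : realType} {V : finType} {P : V -> V -> R}.
Variable alpha : R.
Hypothesis alpha_gt0 : 0 < alpha.
Implicit Types (n : {ffun V * V -> nat}) (a b u v x : V) (p : seq V).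

(** Gam m stands for Gamma (m + alpha). *)
Variable Gam : nat -> R.
Hypothesis Gam_gt0 : forall m, 0 < Gam m.
Hypothesis GamS : forall m, Gam m.+1 = (m%:R + alpha) * Gam m.

Let natDalpha_neq0 (m : nat) : m%:R + alpha != 0.
Proof. by rewrite gt_eqF// ltr_wpDl. Qed.

(** On a symmetric n the minimum and the maximum agree and this is the factor
of {u, v} in the density. Along a walk the two directions of an edge may
differ by one, and putting the minimum in the factorial and the maximum in Gam
is what makes the closed form green_density right for these n too. *)
Definition edge_weight n u v : R :=
  ((minn (n (u, v)) (n (v, u)))`!%:R *
   (if u == v then 1 else Gam (maxn (n (u, v)) (n (v, u)))))^-1.

Lemma edge_weightC n u v : edge_weight n u v = edge_weight n v u.
Proof. by rewrite /edge_weight minnC maxnC eq_sym. Qed.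

Let fact_unit (m : nat) : m`!%:R != 0 :> R.
Proof. by rewrite pnatr_eq0 -lt0n fact_gt0. Qed.

Let Gam_neq0 m : Gam m != 0.
Proof. by rewrite gt_eqF. Qed.

Let factV (m : nat) : (0 < m)%N -> (m.-1)`!%:R^-1 = m%:R * m`!%:R^-1 :> R.
Proof.
by case: m => // m _; rewrite /= factS natrM invfM mulrA divff ?mul1r ?pnatr_eq0.
Qed.

(** What edge_weight gains when a crossing from a to b is used: this lowers
the maximum, hence the argument of Gam, when there is an excess of crossings
from a to b, and lowers the minimum, hence the argument of the factorial,
otherwise. *)
Definition crossing_factor n a b : R :=
  if (n (b, a) < n (a, b))%N then (n (a, b)).-1%:R + alpha else (n (a, b))%:R.

Lemma edge_weight_decr n a b : (0 < n (a, b))%N -> (n (a, b) <= (n (b, a)).+1)%N ->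
  edge_weight (decr n a b) a b = crossing_factor n a b * edge_weight n a b.
Proof.
move=> nab nle; rewrite /edge_weight /crossing_factor !ffunE eqxx subn1 xpair_eqE.
have [ab|ab] := eqVneq a b.
  by rewrite -ab in nab *; rewrite /= ltnn subn1 !minnn !mulr1 factV//.
rewrite /= subn0.
have [lt|ge] := ltnP (n (b, a)) (n (a, b)).
  have nE : n (a, b) = (n (b, a)).+1 by apply/eqP; rewrite eqn_leq nle.
  rewrite nE/= minnn maxnn GamS; field.
  by rewrite Gam_neq0 fact_unit natDalpha_neq0.
have le' : ((n (a, b)).-1 <= n (b, a))%N by rewrite (leq_trans (leq_pred _)).
by rewrite (minn_idPl le') (maxn_idPr le') !invfM factV// mulrA.
Qed.

Let edges_prod n : R := \prod_(uv in oedges P) edge_weight n uv.1 uv.2.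

Let oedge_in a b : edge P a b -> oedge a b \in oedges P.
Proof.
move=> eab; rewrite inE /oedge; case: ifPn => /= [ab|]; first by rewrite eab.
by rewrite -ltnNge edge_sym eab => /ltnW.
Qed.

Lemma edges_prod_decr n a b : edge P a b -> (0 < n (a, b))%N ->
  (n (a, b) <= (n (b, a)).+1)%N ->
  edges_prod (decr n a b) = crossing_factor n a b * edges_prod n.
Proof.
move=> eab nab nle; have oab := oedge_in eab.
have splitE m : edges_prod m = edge_weight m a b *
    \prod_(uv in oedges P | uv != oedge a b) edge_weight m uv.1 uv.2.
  have <- : edge_weight m (oedge a b).1 (oedge a b).2 = edge_weight m a b.
    by rewrite /oedge; case: ifP => _ /=; [reflexivity|exact: edge_weightC].
  exact: (bigD1 _ oab).
rewrite (splitE n) (splitE (decr n a b)) (edge_weight_decr nab nle) mulrA.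
congr (_ * _); apply: eq_bigr => -[u v] /andP[uvin uvab] /=.
have uvr : (enum_rank u <= enum_rank v)%N by move: uvin; rewrite inE => /andP[].
have uvE : oedge u v = (u, v) by rewrite /oedge uvr.
have h1 : (u, v) != (a, b).
  by apply: contraNneq uvab => -[uE vE]; rewrite -uE -vE uvE.
have h2 : (v, u) != (a, b).
  by apply: contraNneq uvab => -[vE uE]; rewrite -uE -vE oedgeC uvE.
by rewrite /edge_weight !ffunE (negbTE h1) (negbTE h2) !subn0.
Qed.

Definition field_density n : R :=
  (Gam 0 ^+ ncomp P)^-1 * \prod_v Gam (outdeg n v) * edges_prod n.

(** The coefficient of z^n in G(a, x) det^(- alpha), with G the Green's
function of the matrix of indeterminates z on the edges; the start a of the
walks is determined by the imbalance of n, so that it does not appear. *)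
Definition green_density x n : R :=
  alpha^-1 * (Gam 0 ^+ ncomp P)^-1 *
  \prod_v Gam (outdeg n v + (v == x)) * edges_prod n.

(** The coefficients of both sides of the rule that the Euler operator at x
maps det^(- alpha) to alpha (G(x, x) - 1) det^(- alpha). *)
Lemma field_green_density x n :
  alpha * green_density x n = ((outdeg n x)%:R + alpha) * field_density n.
Proof.
rewrite /green_density /field_density.
have -> : \prod_v Gam (outdeg n v + (v == x)) =
    ((outdeg n x)%:R + alpha) * \prod_v Gam (outdeg n v).
  rewrite (bigD1 x)//= [in RHS](bigD1 x)//= eqxx addn1 GamS mulrA; congr (_ * _).
  by apply: eq_bigr => v /negbTE vx; rewrite vx addn0.
move: ((Gam 0 ^+ ncomp P)^-1) => g.
by field; rewrite gt_eqF.
Qed.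

Lemma green_density_decr x n a b : edge P a b -> (0 < n (a, b))%N ->
  (n (a, b) <= (n (b, a)).+1)%N ->
  ((outdeg n a).-1%:R + (a == x)%:R + alpha) * green_density x (decr n a b) =
  crossing_factor n a b * green_density x n.
Proof.
move=> eab nab nle; rewrite /green_density edges_prod_decr//.
have oE v := outdeg_decr v nab.
have -> : \prod_v Gam (outdeg n v + (v == x)) =
    ((outdeg n a).-1%:R + (a == x)%:R + alpha) *
    \prod_v Gam (outdeg (decr n a b) v + (v == x)).
  rewrite (bigD1 a)//= [in RHS](bigD1 a)//= mulrA; congr (_ * _).
    by rewrite oE eqxx addn1 addSn GamS natrD.
  by apply: eq_bigr => v /negbTE va; rewrite oE va addn0.
by ring.
Qed.

Definition edge_supported n : Prop := forall u v, ~~ edge P u v -> n (u, v) = 0%N.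

(** First-step decomposition of the walks from a to x: the empty walk, present
if a = x, or a step to some b. Each step multiplies green_density by
crossing_factor over q_a - 1 + [a = x] + alpha, where q_a is the out-degree of
a. The factors add up to q_a, plus alpha - 1 if the path back to x is not
empty. So they exhaust the denominator when a <> x, and fall short of it by
alpha when a = x, which is the share of the empty walk by
field_green_density. *)
Lemma green_density_step x n a p : edge_supported n ->
  uniq (a :: p) -> last a p = x -> flow_along n a p ->
  (a == x)%:R * field_density n +
  \sum_(b | (0 < n (a, b))%N) green_density x (decr n a b) = green_density x n.
Proof.
move=> nsupp uap lx nap.
have headE b := flow_along_head b uap nap.
have nle b : (n (a, b) <= (n (b, a)).+1)%N by rewrite headE; case: (_ == _); lia.
have eab b : (0 < n (a, b))%N -> edge P a b.
  by apply: contraTT => /nsupp ->.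
have px : (a == x) = (p == [::]).
  rewrite -lx; case: p uap {lx nap headE} => [|c p] /= ; first by rewrite !eqxx.
  by move=> /andP[acp _]; apply: contraNF acp => /eqP {1}->; exact: mem_last.
have [deg0|deg0] := posnP (outdeg n a).
  have nab0 b : n (a, b) = 0%N.
    by apply/eqP; rewrite -leqn0 -deg0 /outdeg (bigD1 b)//= leq_addr.
  rewrite big_pred0 ?addr0; last by move=> b; rewrite nab0.
  have p0 : p = [::].
    by case: p {uap lx nap px} headE => // c p /(_ c); rewrite nab0 /= eqxx addn1.
  move: px; rewrite p0 eqxx => /eqP ax; rewrite ax eqxx mul1r -{}ax.
  apply: (mulfI (lt0r_neq0 alpha_gt0)); rewrite field_green_density.
  by rewrite deg0 add0r.
pose A := (outdeg n a).-1%:R + (a == x)%:R + alpha.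
have A0 : A != 0 by rewrite gt_eqF// ltr_wpDl// addr_ge0// ler0n.
apply: (mulfI A0); rewrite mulrDr mulr_sumr.
have factorE b : crossing_factor n a b = (n (a, b))%:R + (ohead p == Some b)%:R * (alpha - 1).
  rewrite /crossing_factor headE; case: eqP => _ /=; last by rewrite addn0 ltnn mul0r addr0.
  by rewrite addn1 ltnSn /= mul1r -natr1; ring.
rewrite (eq_bigr (fun b => crossing_factor n a b * green_density x n)); last first.
  by move=> b nab; rewrite green_density_decr// eab.
rewrite -mulr_suml.
have -> : \sum_(b | (0 < n (a, b))%N) crossing_factor n a b =
    (outdeg n a)%:R + (p != [::])%:R * (alpha - 1).
  rewrite [LHS](_ : _ = \sum_b crossing_factor n a b); last first.
    rewrite [RHS](bigID (fun b => (0 < n (a, b))%N))/= [X in _ = _ + X]big1 ?addr0// => b.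
    rewrite -eqn0Ngt factorE => /eqP nab; rewrite nab add0r.
    by move: (headE b); rewrite nab; case: (_ == _); rewrite ?mul0r// addn1.
  under eq_bigr do rewrite factorE.
  rewrite big_split/= -mulr_suml natr_sum; congr (_ + _ * _).
  case: p {uap lx nap px headE factorE} => [|c p]; first by rewrite big1.
  rewrite (bigD1 c)//= eqxx big1 ?addr0// => b bc.
  by case: eqP => // -[cb]; rewrite cb eqxx in bc.
have deg0' : (outdeg n a)%:R = (outdeg n a).-1%:R + 1 :> R by rewrite natr1 prednK.
have := field_green_density a n; rewrite /A px.
case: (p == [::]) px => /= [/eqP ax|_]; last by move=> _; rewrite deg0'; ring.
by rewrite -ax deg0' => h; rewrite !mul1r mul0r addr0 -h; ring.
Qed.

End FieldDensity.

(** * The density as a coefficient of the loop exponential *)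

Section WalkSums.
Context {R : realType} {V : finType} {P : V -> V -> R}.
Variable alpha : R.
Hypothesis alpha_gt0 : 0 < alpha.
Hypothesis P_forest : star_forest P.
Variable Gam : nat -> R.
Hypothesis Gam_gt0 : forall m, 0 < Gam m.
Hypothesis GamS : forall m, Gam m.+1 = (m%:R + alpha) * Gam m.
Implicit Types (n : {ffun V * V -> nat}) (a b u v x : V) (p : seq V).
Implicit Types (f : {ffun V * V -> nat} -> R).

Local Notation field_density := (field_density (P := P) Gam).
Local Notation green_density := (green_density (P := P) alpha Gam).
Local Notation edge_supported := (edge_supported (P := P)).

(** Sum of f (n - c w) over the walks w from a to x with at most m steps which
cross no edge more often than n does, organised by the first step. *)
Fixpoint walk_sum f x m a n : R :=
  (a == x)%:R * f n +
  (if m is m'.+1 then \sum_(b | (0 < n (a, b))%N) walk_sum f x m' b (decr n a b) else 0).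

Lemma sum_decr n a b : (0 < n (a, b))%N ->
  (\sum_uv n uv = (\sum_uv decr n a b uv).+1)%N.
Proof.
move=> nab; under eq_bigr do rewrite (decrK _ nab).
rewrite big_split/= -addn1; congr (_ + _)%N.
by rewrite (bigD1 (a, b))//= eqxx big1// => uv /negbTE ->.
Qed.

Lemma decr_supported n a b : edge_supported n -> edge_supported (decr n a b).
Proof. by move=> ns u v uv; rewrite ffunE ns. Qed.

(** f is compared with the density only up to the total N, so that the lemma
can be used inside an induction on the total of n. *)
Lemma walk_sum_green f x N m a p n :
  (forall n', edge_supported n' -> (forall u v, n' (u, v) = n' (v, u)) ->
    (\sum_uv n' uv <= N)%N -> f n' = field_density n') ->
  edge_supported n -> path (edge P) a p -> uniq (a :: p) -> last a p = x ->
  flow_along n a p -> (\sum_uv n uv <= m)%N -> (\sum_uv n uv <= N)%N ->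
  walk_sum f x m a n = green_density x n.
Proof.
move=> fE; elim: m a p n => [|m IH] a p n ns ap uap lx nap nm nN;
  rewrite -(green_density_step alpha_gt0 Gam_gt0 GamS ns uap lx nap) /=;
  have -> : (a == x)%:R * f n = (a == x)%:R * field_density n.
  1,3: case: eqP => [ax|_]; rewrite ?mul0r ?mul1r//; apply: fE => // u v.
  1,2: have p0 : p = [::] by case: p uap lx {ap nap} => //= c p /andP[acp _] cx;
         move: acp; rewrite ax -cx mem_last.
  1,2: by have := nap u v; rewrite p0 /path_steps/= !addn0.
  rewrite big_pred0// => b; apply/negbTE; rewrite -leqNgt.
  by rewrite (leq_trans _ nm)// (bigD1 (a, b))//= leq_addr.
congr (_ + _); apply: eq_bigr => b nab.
have eab : edge P a b by move: nab; apply: contraTT => /ns ->.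
have [q [bq ubq lq nq]] := flow_along_decr (edge_sym P) P_forest ap uap lx nap eab nab.
apply: (IH b q) => //; first exact: decr_supported.
  by rewrite -ltnS -sum_decr.
by rewrite (leq_trans _ nN)// (sum_decr nab).
Qed.

Definition residual f n (w : seq (V * V)) : R :=
  if [forall uv, (count_mem uv w <= n uv)%N]
  then f [ffun uv => (n uv - count_mem uv w)%N] else 0.

Lemma residual_nil f n : residual f n [::] = f n.
Proof.
rewrite /residual ifT; last by apply/forallP.
by congr f; apply/ffunP => uv; rewrite ffunE subn0.
Qed.

Lemma residual_cons f n a b w :
  residual f n ((a, b) :: w) =
  if (0 < n (a, b))%N then residual f (decr n a b) w else 0.
Proof.
rewrite /residual; case: ifPn => [/forallP h|/forallPn[[u v] h]].
  have nab : (0 < n (a, b))%N by have := h (a, b); rewrite /= eqxx; exact: leq_trans.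
  rewrite nab ifT; last first.
    by apply/forallP => uv; have := h uv; rewrite ffunE /= eq_sym; lia.
  by congr f; apply/ffunP => uv; rewrite !ffunE /= subnDA eq_sym.
case: ifPn => // nab; rewrite ifF//; apply/negP => /forallP h'.
move: h; rewrite -ltnNge /= (decrK _ nab) [(a, b) == _]eq_sym.
by rewrite [X in (X < _)%N]addnC ltn_add2l ltnNge h'.
Qed.

Lemma residual_perm f n w w' : perm_eq w w' -> residual f n w = residual f n w'.
Proof.
move=> /permP ww'; rewrite /residual.
rewrite (eq_forallb (P2 := fun uv => (count_mem uv w' <= n uv)%N)).
  by congr (if _ then f _ else _); apply/ffunP => uv; rewrite !ffunE ww'.
by move=> uv; rewrite ww'.
Qed.

(** Both sides enumerate the same walks, on the right by length and through
their intermediate vertices, which is the form delivered by sum_loops. *)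
Lemma walk_sum_words f x m a n : edge_supported n ->
  walk_sum f x m a n = (a == x)%:R * f n +
   \sum_(l < m) \sum_(s <- words l | path (edge P) a (rcons s x))
      residual f n (zip (a :: s) (rcons s x)).
Proof.
elim: m a n => [|m IH] a n ns; first by rewrite big_ord0.
rewrite [LHS]/=; congr (_ + _); rewrite big_ord_recl.
have eab b : (0 < n (a, b))%N -> edge P a b by apply: contraTT => /ns ->.
rewrite (_ : words _ = [:: [::]])// big_cons big_nil/= andbT addr0.
rewrite (eq_bigr (fun b => (b == x)%:R * f (decr n a b) + \sum_(l < m)
  \sum_(s <- words l | path (edge P) b (rcons s x))
      residual f (decr n a b) (zip (b :: s) (rcons s x)))); last first.
  by move=> b nab; rewrite IH//; exact: decr_supported.
rewrite big_split/=; congr (_ + _).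
  rewrite residual_cons residual_nil big_mkcond (bigD1 x)//= eqxx mul1r big1.
    by rewrite addr0; case: ifPn => [/eab ->//|_]; case: ifP.
  by move=> b /negbTE ->; rewrite mul0r if_same.
rewrite exchange_big/=; apply: eq_bigr => l _.
rewrite big_words_cons big_mkcond; apply: eq_bigr => b _ /=.
case: ifPn => [nab|nab]; last first.
  by rewrite big1// => s _; rewrite residual_cons (negbTE nab).
rewrite eab//=; apply: eq_bigr => s _.
by rewrite residual_cons nab.
Qed.

(** Each vertex contributes Gam 0 to the numerator, and each component and
each edge other than a self-loop contributes it to the denominator. *)
Lemma field_density0 : field_density [ffun=> 0%N] = 1.
Proof.
have Gam0 : Gam 0 != 0 by rewrite gt_eqF.
rewrite /field_density.
rewrite (eq_bigr (fun=> Gam 0)); last first.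
  by move=> v _; rewrite /outdeg big1// => y _; rewrite ffunE.
rewrite prodr_const.
have [m mE ->] : exists2 m, (m + ncomp P)%N = #|V| &
    \prod_(uv in oedges P) edge_weight Gam [ffun=> 0%N] uv.1 uv.2 = (Gam 0)^-1 ^+ m.
  eexists; first exact: card_nonloop_edges (edge_sym P) P_forest.
  rewrite -prodr_const (bigID (fun uv => uv.1 == uv.2))/= big1 ?mul1r.
    apply: eq_big => [uv|uv /andP[_ /negbTE uv12]]; first by rewrite !inE andbA.
    by rewrite /edge_weight !ffunE minnn maxnn fact0 mul1r uv12.
  by move=> uv /andP[_ uv12]; rewrite /edge_weight !ffunE minnn fact0 mul1r uv12 invr1.
by rewrite -mE addnC exprD mulKf ?expf_neq0// exprVn divff// expf_neq0.
Qed.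

Lemma count_steps_from (s : seq V) x :
  (\sum_(uv | uv.1 == x) count_mem uv (steps s))%N = count_mem x s.
Proof.
have -> : count_mem x s = count (fun uv => uv.1 == x) (steps s).
  rewrite -(count_map fst (pred1 x)); congr count.
  by rewrite -[LHS](@unzip1_zip _ _ s (rot 1 s)) ?size_rot.
elim: (steps s) => [|uv w IH]; first by rewrite big1.
rewrite /= -IH big_split/=; congr (_ + _)%N.
rewrite big_mkcond (bigD1 uv)//= eqxx big1 ?addn0; first by case: ifP.
by move=> uv' /negbTE; rewrite eq_sym => ->; rewrite if_same.
Qed.

Lemma sum_count_steps (s : seq V) : (\sum_uv count_mem uv (steps s) = size s)%N.
Proof.
have -> : size s = size (steps s) by rewrite size_zip size_rot minnn.
elim: (steps s) => [|uv w IH]; first by rewrite big1.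
rewrite /= -IH big_split/= (bigD1 uv)//= eqxx big1 ?addn0//.
by move=> uv' /negbTE; rewrite eq_sym => ->.
Qed.

(** Induction on the total of n. For a vertex x with q_x > 0 the recurrence
expresses q_x C n by values of C at smaller arguments, where C agrees with the
density. It thus gives the sum of the density over the nonempty closed walks
from x, which green_density_step and field_green_density evaluate. *)
Lemma exp_coef_loops K n : edge_supported n ->
  (forall u v, n (u, v) = n (v, u)) -> (\sum_uv n uv <= K)%N ->
  exp_coef (fun i : 'I_(size (@loops_le R V P K)) =>
       alpha / (multiplicity (tnth (in_tuple (@loops_le R V P K)) i))%:R)
     (fun i uv => crossings (tnth (in_tuple (@loops_le R V P K)) i) uv.1 uv.2) K n =
  field_density n.
Proof.
set us := @loops_le R V P K; pose gl i := tnth (in_tuple us) i.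
set cf := exp_coef _ _ K.
have [m] := ubnP (\sum_uv n uv)%N; elim: m n => // m IH n nm ns nsym nK.
have [n0|/eqP n0] := eqVneq (\sum_uv n uv)%N 0%N.
  have -> : n = [ffun=> 0%N].
    apply/ffunP => uv; rewrite ffunE; apply/eqP; rewrite -leqn0 -n0.
    by rewrite (bigD1 uv)//= leq_addr.
  rewrite field_density0 /cf exp_coef0// => i.
  by rewrite sum_count_steps lseq_gt0.
have [x nx] : exists x, (0 < outdeg n x)%N.
  apply/existsP; apply: contra_notT n0 => /existsPn h.
  rewrite big1// => -[u v] _; apply/eqP; rewrite -leqn0.
  by have := h u; rewrite -leqNgt; apply: leq_trans; rewrite /outdeg (bigD1 v)//= leq_addr.
have outE : outdeg n x = (\sum_(uv | uv.1 == x) n uv)%N.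
  rewrite /outdeg (reindex_onto (fun y => (x, y)) snd)/=; last by move=> [u v] /eqP /= ->.
  by apply: eq_bigl => y; rewrite !eqxx.
apply: (@mulfI _ (outdeg n x)%:R); first by rewrite pnatr_eq0 -lt0n.
rewrite [in LHS]outE /cf exp_coef_deriv//; last by move=> i; rewrite sum_count_steps lseq_gt0.
rewrite -/cf.
transitivity (alpha * \sum_(g <- us) (multiplicity g)%:R^-1 * (visits g x)%:R *
    residual cf n (steps (lseq g))).
  rewrite [in RHS]big_tnth mulr_sumr; apply: eq_bigr => i _.
  rewrite (_ : (\sum_(uv | _) _)%N = visits (gl i) x); last first.
    by rewrite /visits -count_steps_from; apply: eq_bigr => -[].
  by rewrite !mulrA; congr (_ * _).
rewrite /us (sum_loops K x (F := fun s => residual cf n (steps s))); last first.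
  by move=> s i; apply: residual_perm; rewrite steps_rot perm_rot.
have K0 : (0 < K)%N by rewrite (leq_trans _ nK)// lt0n; exact/eqP.
transitivity (alpha * \sum_(b | (0 < n (x, b))%N) green_density x (decr n x b)).
  (* adding the empty walk on both sides completes walk_sum *)
  congr (_ * _); apply: (@addrI _ ((x == x)%:R * cf n)).
  under eq_bigr => l _ do (under eq_bigr => s _ do rewrite /steps rot1_cons).
  rewrite -walk_sum_words// -(prednK K0) /=; congr (_ + _); apply: eq_bigr => b nxb.
  have exb : edge P x b by move: nxb; apply: contraTT => /ns ->.
  have [//|//|u v|q [bq ubq lq nq]] :=
    @flow_along_decr _ (edge P) n x [::] b x (edge_sym P) P_forest _ _ erefl _ exb nxb.
    by rewrite nsym.
  have nb := sum_decr nxb.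
  apply: (@walk_sum_green _ _ (\sum_uv decr n x b uv)%N _ _ q) => //.
  - move=> n' ns' nsym' n'n; apply: IH => //; last first.
      by rewrite (leq_trans n'n)// (leq_trans _ nK)// nb.
    by rewrite (leq_ltn_trans n'n)// -ltnS -nb.
  - exact: decr_supported.
  - by rewrite -ltnS prednK// -nb.
have := @green_density_step _ _ _ _ alpha_gt0 _ Gam_gt0 GamS x n x [::] ns isT erefl.
move=> /(_ _)/wrap[]; first by move=> u v; rewrite nsym.
have := field_green_density alpha_gt0 GamS x n (P := P).
rewrite eqxx mul1r => fg st; move: fg; rewrite -st mulrDr mulrDl [RHS]addrC.
by move=> /addrI.
Qed.

End WalkSums.

(** * Symmetry and uniqueness of flows *)

Section FlowSymmetry.
Context {R : realType} {V : finType} {P : V -> V -> R}.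
Hypothesis P_forest : star_forest P.
Implicit Types (n : {ffun V * V -> nat}) (q : V -> nat).

(** If n (u, v) > n (v, u), the balance at v forces an excess of crossings
from v to some other neighbour, and so on without end. *)
Lemma Tq_sym q n : Tq P q n -> forall u v, n (u, v) = n (v, u).
Proof.
move=> [ns nbal _] u v.
suff nle u' v' : (n (u', v') <= n (v', u'))%N by apply/eqP; rewrite eqn_leq !nle.
have [->//|uv'] := eqVneq u' v'; rewrite leqNgt.
apply: (@dead_end_free_rel _ (edge P) (edge_sym P) P_forest
  (fun x y => (n (y, x) < n (x, y))%N)) => // [x y /= nyx|x y xy nyx].
  by apply: contraTT nyx => /ns ->.
have [w nw] : exists w, (n (w, y) < n (y, w))%N.
  apply/existsP; apply: contraTT nyx => /existsPn h; rewrite -leqNgt.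
  have /leqif_sum/= : forall w, true -> (n (y, w) <= n (w, y) ?= iff (n (y, w) == n (w, y)))%N.
    by move=> w _; split => //; rewrite leqNgt h.
  move=> [_]; rewrite nbal eqxx => /esym/forallP/(_ x)/= /eqP ->.
  exact: leqnn.
exists w; split => //; first by apply: contraTneq nw => ->; rewrite -leqNgt ltnW.
by apply: contraTneq nw => ->; rewrite ltnn.
Qed.

(** If two flows differ on an edge at y, then, having the same total at y,
they differ on another edge at y. Self-loops would absorb the difference,
which is why they are excluded here. *)
Lemma Tq_inj q n n' : (forall x, ~~ edge P x x) -> Tq P q n -> Tq P q n' -> n = n'.
Proof.
move=> noloop nq n'q; apply/ffunP => -[u v].
have nsym := Tq_sym nq; have n'sym := Tq_sym n'q.
have [ns _ nr] := nq; have [n's _ n'r] := n'q.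
have [<-|uv] := eqVneq u v; first by rewrite ns// n's.
apply/eqP; rewrite -[_ == _]negbK.
apply: (@dead_end_free_rel _ (edge P) (edge_sym P) P_forest
  (fun x y => n (x, y) != n' (x, y))) => // [x y /= nn'|x y xy nn'].
  by apply: contraTT nn' => xy; rewrite ns// n's.
have [w /andP[wx nw]] : exists w, (w != x) && (n (y, w) != n' (y, w)).
  apply/existsP; apply: contraTT nn' => /existsPn h; rewrite negbK.
  have := nr y; rewrite -(n'r y) (bigD1 x)//= [RHS](bigD1 x)//= => nE.
  rewrite nsym n'sym -(eqn_add2r (\sum_(i | i != x) n (y, i))) nE; apply/eqP.
  by congr (_ + _)%N; apply: eq_bigr => w wx; have := h w; rewrite wx negbK => /eqP.
exists w; split => //.
by apply: contraTneq nw => ->; rewrite ns ?n's ?eqxx.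
Qed.

(** On a symmetric n the minimum and the maximum in edge_weight are both
n (u, v). *)
Lemma field_termE (alpha : R) q n : Tq P q n ->
  (Gamma alpha ^+ ncomp P)^-1 * field_term P alpha q n =
  field_density (P := P) (fun m => Gamma (m%:R + alpha)) n *
    \prod_x \prod_y P x y ^+ n (x, y).
Proof.
move=> nq; have nsym := Tq_sym nq; have [_ _ nr] := nq.
rewrite /field_term /field_density add0r.
have -> : \prod_x Gamma ((q x)%:R + alpha) = \prod_x Gamma ((outdeg n x)%:R + alpha).
  by apply: eq_bigr => x _; rewrite -nr.
have -> : ((\prod_(e in oedges P) (n e)`!%:R) *
   (\prod_(e in oedges P | e.1 != e.2) Gamma ((n e)%:R + alpha)))^-1 =
   \prod_(uv in oedges P) edge_weight (fun m => Gamma (m%:R + alpha)) n uv.1 uv.2.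
  rewrite big_mkcondr -big_split/= -prodfV; apply: eq_bigr => -[u v] _.
  rewrite /edge_weight [(_, _).1]/= [(_, _).2]/= (nsym v u) minnn maxnn.
  by case: (u == v).
by rewrite !mulrA.
Qed.

End FlowSymmetry.

(** * The total mass of the loop measure *)

Section LoopMass.
Context {R : realType} {V : finType} {P : V -> V -> R}.
Implicit Types (g : uloop P) (a b x y : V).

Lemma sum_enum_val (F : 'I_#|V| -> R) : \sum_i F i = \sum_(x : V) F (enum_rank x).
Proof. by rewrite (reindex (@enum_rank V)) //; apply: onW_bij; exact: enum_rank_bij. Qed.

Lemma nstepS k x y : nstep P k.+1 x y = \sum_z P x z * nstep P k z y.
Proof.
rewrite /nstep exprS mxE sum_enum_val; apply: eq_bigr => z _.
by rewrite mxE !enum_rankK.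
Qed.

Lemma nstep_words l a x : nstep P l.+1 a x =
  \sum_(s <- words l | path (edge P) a (rcons s x))
    \prod_(e <- zip (a :: s) (rcons s x)) P e.1 e.2.
Proof.
have P0 u v : ~~ edge P u v -> P u v = 0 by rewrite negb_or negbK => /andP[/eqP].
elim: l a => [|l IH] a.
  rewrite nstepS (bigD1 x)//= [X in _ + X]big1 ?addr0 => [|z zx]; last first.
    by rewrite /nstep expr0 mxE (inj_eq enum_rank_inj) (negbTE zx) mulr0.
  rewrite /nstep expr0 mxE eqxx mulr1 (_ : words _ = [:: [::]])// big_cons big_nil.
  rewrite /= andbT addr0 big_cons big_nil/= mulr1.
  by case: ifPn => // /P0.
rewrite nstepS big_words_cons; apply: eq_bigr => b _ /=.
rewrite IH; have [eab|/P0 ->] := boolP (edge P a b); last first.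
  by rewrite mul0r big_pred0.
by rewrite mulr_sumr; apply: eq_bigr => s _; rewrite big_cons.
Qed.

Lemma trace_nstep k : \tr (tmx P ^+ k) = \sum_x nstep P k x x.
Proof. by rewrite /mxtrace sum_enum_val. Qed.

Lemma sum_visits g : (\sum_x visits g x = size (lseq g))%N.
Proof.
rewrite /visits; elim: (lseq g) => [|y s IH]; first by rewrite big1.
rewrite /= -IH big_split/= (bigD1 y)//= eqxx big1 ?addn0//.
by move=> z /negbTE; rewrite eq_sym => ->.
Qed.

(** Each loop is weighted by 1 = sum_x visits / length, so that sum_loops
applies at each x; the closed walks of length k + 1 from x contribute
nstep P k.+1 x x / (k + 1). *)
Lemma sum_loops_le_trace K :
  \sum_(g <- @loops_le R V P K) ((multiplicity g)%:R^-1 * weight g) =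
  \sum_(k < K) \tr (tmx P ^+ k.+1) / k.+1%:R.
Proof.
pose F (s : seq V) : R := (size s)%:R^-1 * \prod_(e <- steps s) P e.1 e.2.
have Frot s i : F (rot i s) = F s.
  by rewrite /F size_rot steps_rot; congr (_ * _); apply: perm_big; rewrite perm_rot.
transitivity (\sum_x \sum_(g <- @loops_le R V P K)
    (multiplicity g)%:R^-1 * (visits g x)%:R * F (lseq g)).
  rewrite exchange_big/=; apply: eq_bigr => g _.
  rewrite -mulr_suml -mulr_sumr -natr_sum.
  rewrite sum_visits.
  rewrite /F mulrA mulfK ?pnatr_eq0 -?lt0n ?lseq_gt0//.
under eq_bigr do rewrite (sum_loops _ _ Frot).
rewrite exchange_big/=; apply: eq_bigr => l _.
rewrite trace_nstep mulr_suml; apply: eq_bigr => x _.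
rewrite nstep_words mulr_suml big_seq_cond [RHS]big_seq_cond; apply: eq_bigr => s.
rewrite mem_words => /andP[/eqP sl _].
by rewrite /F /steps rot1_cons /= sl mulrC.
Qed.

Hypothesis P_submarkov : submarkov P.
Hypothesis P_transient : transient P.

Lemma nstep_ge0 k x y : 0 <= nstep P k x y.
Proof. by apply: expmx_ge0 => i j; rewrite mxE; exact: P_submarkov.1. Qed.

Lemma cvg_series_nstep (i j : 'I_#|V|) : cvgn (series (fun k => (tmx P ^+ k) i j)).
Proof.
have kE k : (tmx P ^+ k) i j = nstep P k (enum_val i) (enum_val j).
  by rewrite /nstep !enum_valK.
apply: nondecreasing_is_cvgn.
  by apply: nondecreasing_series => k _ _; rewrite kE nstep_ge0.
exists (fine (green P (enum_val i) (enum_val j))) => _ [N _ <-].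
have gfin : green P (enum_val i) (enum_val j) \is a fin_num.
  rewrite ge0_fin_numE ?P_transient//.
  by apply: nneseries_ge0 => k _ _; rewrite lee_fin nstep_ge0.
rewrite -lee_fin fineK// /series/= -sumEFin.
apply: le_trans (nneseries_lim_ge N _); last first.
  by move=> k _ _; rewrite lee_fin nstep_ge0.
by apply: lee_sum => k _; rewrite kE.
Qed.

Lemma weight_ge0 g : 0 <= weight g.
Proof. by apply: prodr_ge0 => e _; exact: P_submarkov.1. Qed.

(** The loops with at most N steps have the mass of the truncated logarithm,
and any finite set of loops is contained in one of these sets. *)
Lemma loop_mass_total : exists2 ell : R, loop_measure [set: uloop P] = ell%:E &
  \det (1%:M - tmx P) * expR ell = 1.
Proof.
pose ell_ N : R := \sum_(k < N) \tr (tmx P ^+ k.+1) / k.+1%:R.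
have tmx_ge0 i j : 0 <= tmx P i j by rewrite mxE; exact: P_submarkov.1.
have tr_ge0 k : 0 <= \tr (tmx P ^+ k).
  by apply: sumr_ge0 => i _; exact: expmx_ge0.
have ell_nd : nondecreasing_seq ell_.
  by apply/nondecreasing_seqP => N; rewrite /ell_ big_ord_recr/= lerDl divr_ge0.
have ell_cvg : cvgn ell_.
  apply: nondecreasing_is_cvgn => //.
  exists (\sum_i limn (series (fun k => (tmx P ^+ k) i i))) => _ [N _ <-].
  by apply: logtrace_le => //; exact: cvg_series_nstep.
have w0 g : (0 <= ((multiplicity g)%:R^-1 * weight g)%:E :> \bar R)%E.
  by rewrite lee_fin mulr_ge0// weight_ge0.
have mass_ge N : ((ell_ N)%:E <= loop_measure [set: uloop P])%E.
  apply: esum_ge; exists [set` loops_le N]; first by split => //; exact: finite_seq.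
  by rewrite -fsbig_seq ?undup_uniq// sumEFin sum_loops_le_trace.
have mass_le : (loop_measure [set: uloop P] <= (limn ell_)%:E)%E.
  apply: ge_ereal_sup => _ [X [finX _] <-].
  have [N XN] : exists N, X `<=` [set` loops_le N].
    have /finite_seqP[r ->] := finX.
    exists (\max_(g <- r) size (lseq g))%N => g /= rg.
    by rewrite mem_loops_le; exact: leq_bigmax_seq.
  apply: (@le_trans _ _ (ell_ N)%:E); last first.
    by rewrite lee_fin nondecreasing_cvgn_le.
  rewrite /ell_ -sum_loops_le_trace -sumEFin [leRHS]fsbig_seq ?undup_uniq//.
  by apply: lee_fsum_nneg_subset => //; exact/subsetP.
have mass_fin : loop_measure [set: uloop P] \is a fin_num.
  by rewrite ge0_fin_numE ?(le_lt_trans mass_le) ?ltry//; exact: esum_ge0.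
exists (limn ell_).
  apply/eqP; rewrite eq_le mass_le/= -(fineK mass_fin) lee_fin.
  by apply: limr_le => //; apply: nearW => N; rewrite -lee_fin fineK.
have d1 := det_expR_trace tmx_ge0 cvg_series_nstep.
have d2 : \det (1%:M - tmx P) * expR (ell_ N) @[N --> \oo] -->
    \det (1%:M - tmx P) * expR (limn ell_).
  apply: cvgMl_tmp; apply: continuous_cvg; first exact: continuous_expR.
  exact: ell_cvg.
exact: (cvg_unique _ d2 d1).
Qed.

End LoopMass.

(** * The law of the fields of the loop soup *)

Lemma le_esum_setT (R : realType) (T : choiceType) (A : set T) (a : T -> \bar R) :
  (forall t, 0 <= a t)%E -> (\esum_(t in A) a t <= \esum_(t in setT) a t)%E.
Proof.
by move=> a0; rewrite [leRHS](esumID A)// setTI leeDl//; exact: esum_ge0.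
Qed.

Section LoopSoupFields.
Context {R : realType} {V : finType} {P : V -> V -> R}.
Context {d : measure_display} {Omega : measurableType d}.
Variables (Pr : probability Omega R) (alpha : R) (L : Omega -> uloop P -> nat).
Hypothesis P_submarkov : submarkov P.
Hypothesis L_soup : loop_soup Pr alpha L.
Implicit Types (g : uloop P) (n : {ffun V * V -> nat}) (q : V -> nat) (w : Omega).

(** A condition on infinitely many loops at once; under it the fields are
finite sums over loops_le K. *)
Definition no_long_loop w K : Prop := forall g, (K < size (lseq g))%N -> L w g = 0%N.

Lemma esum_setT_loops (a : uloop P -> \bar R) K : (forall g, 0 <= a g)%E ->
  (\esum_(g in setT) a g =
   \sum_(g <- loops_le K) a g + \esum_(g in ~` [set` loops_le K]) a g)%E.
Proof.
move=> a0; rewrite (esumID [set` loops_le K])// !setTI; congr (_ + _)%E.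
by rewrite esum_fset// -?fsbig_seq ?undup_uniq//; exact: finite_seq.
Qed.

Lemma esum_no_long_loop w K (c : uloop P -> nat) : no_long_loop w K ->
  (\esum_(g in setT) (L w g * c g)%N%:R%:E =
   (\sum_(g <- @loops_le R V P K) L w g * c g)%N%:R%:E :> \bar R)%E.
Proof.
move=> wK; rewrite (esum_setT_loops K); last by move=> g; rewrite lee_fin.
rewrite esum1 ?adde0; last first.
  move=> g /= /negP; rewrite mem_loops_le -ltnNge => /wK ->.
  by rewrite mul0n.
by rewrite sumEFin natr_sum.
Qed.

Lemma esum_loop_le w (c : uloop P -> nat) (m : nat) g :
  (\esum_(g in setT) (L w g * c g)%N%:R%:E = m%:R%:E :> \bar R)%E ->
  (L w g * c g <= m)%N.
Proof.
move=> h; rewrite -(ler_nat R) -lee_fin -h; apply: esum_ge.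
by exists [set g]; rewrite ?fsbig_set1//; split => //; exact: finite_set1.
Qed.

(** A single loop of length greater than K would already contribute more than
K crossings. *)
Lemma edge_field_no_long_loop w n K : edge_field_eq L n w -> (\sum_uv n uv <= K)%N ->
  no_long_loop w K.
Proof.
move=> wn nK g Kg; apply/eqP; rewrite -leqn0 leqNgt; apply/negP => Lg.
have : (size (lseq g) <= \sum_uv n uv)%N.
  rewrite -sum_count_steps; apply: leq_sum => -[x y] _.
  apply: leq_trans (esum_loop_le g (wn x y)).
  by rewrite leq_pmull.
by rewrite leqNgt (leq_ltn_trans nK).
Qed.

Lemma theta_no_long_loop w q : theta_eq L q w -> no_long_loop w (\sum_x q x).
Proof.
move=> wq g Kg; apply/eqP; rewrite -leqn0 leqNgt; apply/negP => Lg.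
have : (size (lseq g) <= \sum_x q x)%N.
  rewrite -sum_visits; apply: leq_sum => x _.
  by apply: leq_trans (esum_loop_le g (wq x)); rewrite leq_pmull.
by rewrite leqNgt Kg.
Qed.

Lemma sum_crossings_out g x : (\sum_y crossings g x y = visits g x)%N.
Proof.
rewrite /visits -count_steps_from.
rewrite (reindex_onto (fun y => (x, y)) snd)/=; last by move=> [u v] /eqP /= ->.
by apply: eq_bigl => y; rewrite !eqxx.
Qed.

Lemma sum_crossings_in g x : (\sum_y crossings g y x = visits g x)%N.
Proof.
have -> : visits g x = count (fun uv => uv.2 == x) (steps (lseq g)).
  rewrite -(count_map snd (pred1 x)).
  rewrite [map _ _](@unzip2_zip _ _ (lseq g) (rot 1 (lseq g))) ?size_rot//.
  by rewrite /visits; apply/permP; rewrite perm_sym perm_rot.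
rewrite /crossings; elim: (steps (lseq g)) => [|[u v] s IH]; first by rewrite big1.
rewrite /= -IH big_split/=; congr (_ + _)%N.
rewrite (bigD1 u)//= xpair_eqE eqxx /= big1 ?addn0// => y /negbTE yu.
by rewrite xpair_eqE eq_sym yu.
Qed.

Lemma crossings_edge g x y : ~~ edge P x y -> crossings g x y = 0%N.
Proof.
move=> xy; apply/eqP; rewrite -leqn0 leqNgt -has_count; apply/hasPn => -[u v].
move=> uvs; apply: contra xy => /eqP [<- <-].
have := cycle_lseq g; move: uvs; rewrite /steps; case: (lseq g) => // a s.
rewrite rot1_cons [cycle _ _]/=.
elim: s {1 3}a => [|b s IH] c /=; first by rewrite inE => /eqP[-> ->] /andP[].
by rewrite inE => /orP[/eqP[-> ->]|uvs] /andP[// _]; exact: IH.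
Qed.

Lemma prod_count_mem (F : V * V -> R) (s : seq (V * V)) :
  \prod_(e <- s) F e = \prod_uv F uv ^+ count_mem uv s.
Proof.
elim: s => [|e s IH]; first by rewrite big_nil big1// => uv _; rewrite expr0.
rewrite big_cons IH; under [RHS]eq_bigr do rewrite /= exprD.
rewrite big_split/=; congr (_ * _).
rewrite (bigD1 e)//= eqxx expr1 big1 ?mulr1// => uv /negbTE.
by rewrite eq_sym => ->; rewrite expr0.
Qed.

(** The crossings of any configuration of loops are balanced at each vertex
and supported on edges, so a field N whose out-degrees are q lies in Tq P
q. *)
Lemma theta_edge_field q :
  theta_eq L q = \bigcup_(n in Tq P q) edge_field_eq L n.
Proof.
apply/seteqP; split => [w wq|w [n [ns nbal nq] wn] x].
  have wK := theta_no_long_loop wq; set K := (\sum_x q x)%N in wK.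
  pose n : {ffun V * V -> nat} :=
    [ffun uv => (\sum_(g <- @loops_le R V P K) L w g * crossings g uv.1 uv.2)%N].
  have outE x : (\sum_y n (x, y) = \sum_(g <- @loops_le R V P K) L w g * visits g x)%N.
    under eq_bigr do rewrite ffunE; rewrite exchange_big/=; apply: eq_bigr => g _.
    by rewrite -big_distrr/= sum_crossings_out.
  have inE x : (\sum_y n (y, x) = \sum_(g <- @loops_le R V P K) L w g * visits g x)%N.
    under eq_bigr do rewrite ffunE; rewrite exchange_big/=; apply: eq_bigr => g _.
    by rewrite -big_distrr/= sum_crossings_in.
  exists n; last by move=> x y; rewrite /edge_field (esum_no_long_loop _ wK) ffunE.
  split.
  - by move=> x y xy; rewrite ffunE big1// => g _; rewrite crossings_edge// muln0.
  - by move=> x; rewrite outE inE.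
  - move=> x; rewrite outE; apply/eqP; rewrite -(eqr_nat R) -eqe.
    by rewrite -(esum_no_long_loop _ wK); apply/eqP; exact: wq.
have wK := edge_field_no_long_loop wn (leqnn _).
rewrite /theta (esum_no_long_loop _ wK) -nq; congr (_%:R%:E).
under eq_bigr do rewrite -sum_crossings_out big_distrr/=.
rewrite exchange_big/=; apply: eq_bigr => y _; apply/eqP.
rewrite -(eqr_nat R) -eqe -(esum_no_long_loop (fun g => crossings g x y) wK).
by apply/eqP; exact: wn.
Qed.

Section Configurations.
Variable K : nat.
Local Notation us := (@loops_le R V P K).
Local Notation m := (size us).
Local Notation lp := (tnth (in_tuple us)).

(** As index g us is the length m of us for every g outside us, the cells are
the singletons of the loops of length at most K, followed by one cell for all
longer loops: a finite partition, to which the independence of the counts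
applies. *)
Definition cell (i : 'I_m.+1) : set (uloop P) := [set g | index g us = i].

(** The cell of the longer loops has index m, for which insub fails; it is
required to be empty of points. *)
Definition loop_count (k : {ffun 'I_m -> 'I_K.+1}) (i : 'I_m.+1) : nat :=
  oapp (fun j => k j : nat) 0%N (insub (i : nat)).

Definition config (k : {ffun 'I_m -> 'I_K.+1}) : set Omega :=
  [set w | forall i, npoints (R := R) L (cell i) w = (loop_count k i)%:R%:E].

Let loop_count_widen k j : loop_count k (widen_ord (leqnSn m) j) = k j.
Proof.
have jE : insub (widen_ord (leqnSn m) j : nat) = Some j :> option 'I_m := valK j.
by rewrite /loop_count jE.
Qed.

Let loop_count_max k : loop_count k ord_max = 0%N.
Proof. by rewrite /loop_count insubF//= ltnn. Qed.

Let cell_widen j : cell (widen_ord (leqnSn m) j) = [set lp j].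
Proof.
apply/seteqP; split => [g /= gj|g ->] /=.
  have {}gj : index g us = j := gj.
  by rewrite (tnth_nth g)/= -gj nth_index// -index_mem gj.
have g0 := lp j; rewrite (tnth_nth g0) /cell/=.
by rewrite index_uniq// undup_uniq.
Qed.

Let cell_max : cell ord_max = ~` [set` us].
Proof.
apply/seteqP; split => g /=; first by move=> gm /= gus; rewrite -index_mem gm ltnn in gus.
by move=> /negP gus; apply/eqP; rewrite eqn_leq index_size leqNgt index_mem.
Qed.

Lemma configP k w : config k w <-> (forall j, L w (lp j) = k j :> nat) /\ no_long_loop w K.
Proof.
have npE A : npoints (R := R) L A w = (\esum_(g in A) (L w g)%:R%:E)%E by [].
split=> [wk|[wk wK] i].
  split=> [j|g Kg].
    have := wk (widen_ord (leqnSn m) j); rewrite loop_count_widen cell_widen npE.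
    by rewrite esum_set1 ?lee_fin// => -[/eqP]; rewrite eqr_nat => /eqP.
  have := wk ord_max; rewrite loop_count_max cell_max npE => h.
  apply/eqP; rewrite -leqn0 -(ler_nat R) -lee_fin -h; apply: esum_ge.
  exists [set g]; rewrite ?fsbig_set1//; split; first exact: finite_set1.
  by move=> _ -> /=; rewrite mem_loops_le; apply/negP; rewrite -ltnNge.
have [->|im] := eqVneq i ord_max.
  rewrite loop_count_max cell_max npE esum1// => g /= /negP.
  by rewrite mem_loops_le -ltnNge => /wK ->.
have [j ->] : exists j, i = widen_ord (leqnSn m) j.
  have lim : (i < m)%N by rewrite ltn_neqAle -ltnS ltn_ord andbT; exact: im.
  by exists (Ordinal lim); exact: val_inj.
by rewrite loop_count_widen cell_widen npE esum_set1 ?lee_fin// wk.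
Qed.

Let measurable_L g (c : nat) : measurable [set w | L w g = c].
Proof.
have [mL _ _] := L_soup; have := mL g measurableT [set c].
by rewrite setTI; apply.
Qed.

(** The last cell is infinite, but containing no point is a countable
intersection of conditions on single loops, indexed by a bound on the
length. *)
Lemma measurable_config k : measurable (config k).
Proof.
have -> : config k = \bigcap_(j in [set: 'I_m]) [set w | L w (lp j) = k j] `&`
    \bigcap_N \bigcap_(g in [set` [seq g <- loops_le N | (K < size (lseq g))%N]])
      [set w | L w g = 0%N].
  apply/seteqP; split => w.
    move=> /configP[wk wK]; split => [j _|N _ g /=]; first exact: wk.
    by rewrite mem_filter => /andP[/wK].
  move=> [wk wK]; apply/configP; split=> [j|g Kg]; first exact: wk.
  apply: (wK (size (lseq g)) I g) => /=.
  by rewrite mem_filter Kg mem_loops_le leqnn.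
apply: measurableI.
  by apply: fin_bigcap_measurable => [|j _]; [exact: finite_finset|exact: measurable_L].
apply: bigcapT_measurable => N.
by apply: fin_bigcap_measurable => [|g _]; [exact: finite_seq|exact: measurable_L].
Qed.

Local Notation cross := (fun (i : 'I_m) (uv : V * V) => crossings (lp i) uv.1 uv.2).

Let edge_field_configE w k n : config k w ->
  edge_field_eq L n w <-> total_is cross n k.
Proof.
move=> /configP[wk wK].
have fE x y : edge_field L w x y = (\sum_i k i * cross i (x, y))%N%:R%:E.
  rewrite /edge_field (esum_no_long_loop _ wK); congr (_%:R%:E).
  by rewrite big_tnth; apply: eq_bigr => i _; rewrite wk.
split=> [wn|/forallP kn x y]; last by rewrite fE (eqP (kn (x, y))).
apply/forallP => -[x y]; have := wn x y; rewrite fE => -[/eqP].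
by rewrite eqr_nat.
Qed.

(** Distinct configurations being disjoint, this turns the probability of
{N = n} into a finite sum. *)
Lemma edge_field_config n : (\sum_uv n uv <= K)%N ->
  edge_field_eq L n = \bigcup_(k in [set k | total_is cross n k]) config k.
Proof.
move=> nK; apply/seteqP; split => [w wn|w [k /= nk wk]]; last first.
  exact/(edge_field_configE n wk).
have wK := edge_field_no_long_loop wn nK.
pose k : {ffun 'I_m -> 'I_K.+1} := [ffun i => inord (L w (lp i))].
have wk : config k w.
  apply/configP; split => // i; rewrite ffunE inordK// ltnS.
  apply: leq_trans nK; apply: (@leq_trans (\sum_uv L w (lp i) * cross i uv)%N).
    by rewrite -big_distrr/= leq_pmulr// sum_count_steps lseq_gt0.
  by apply: leq_sum => -[x y] _; exact: (esum_loop_le (lp i) (wn x y)).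
by exists k => //=; apply/(edge_field_configE n wk).
Qed.

(** The factors exp (- alpha mu(cell)) of the Poisson laws multiply to a
constant, the cells forming a partition. *)
Lemma Pr_config k ell : loop_measure [set: uloop P] = ell%:E ->
  Pr (config k) = (expR (- (alpha * ell)) *
    \prod_i ((alpha * ((multiplicity (lp i))%:R^-1 * weight (lp i))) ^+ k i / (k i)`!%:R))%:E.
Proof.
move=> ellE; have [_ Ppois Pind] := L_soup.
have w0 g : (0 <= ((multiplicity g)%:R^-1 * weight g)%:E :> \bar R)%E.
  by rewrite lee_fin mulr_ge0// weight_ge0.
have lm_le (A : set (uloop P)) : (loop_measure A <= ell%:E)%E.
  by rewrite -ellE; exact: (le_esum_setT A w0).
have lm_fin (A : set (uloop P)) : loop_measure A \is a fin_num.
  by rewrite ge0_fin_numE ?(le_lt_trans (lm_le _)) ?ltry//; exact: esum_ge0.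
have nu_lty (A : set (uloop P)) : (alpha%:E * loop_measure A < +oo)%E.
  by rewrite -(fineK (lm_fin A)) -EFinM ltry.
have fnu (A : set (uloop P)) : fine (alpha%:E * loop_measure A) = alpha * fine (loop_measure A).
  by rewrite fineM.
have lm_sum : \sum_i fine (loop_measure (cell i)) = ell.
  apply: EFin_inj; rewrite -sumEFin big_ord_recr/= fineK// cell_max.
  rewrite -ellE [in RHS]/loop_measure (esum_setT_loops K)//.
  apply: (@f_equal2 _ _ _ (fun x y => x + y)%E) => //.
  rewrite [RHS]big_tnth; apply: eq_bigr => j _.
  by rewrite fineK// cell_widen /loop_measure esum_set1.
rewrite /config Pind//; last first.
  by move=> i j _ _ [g [gi gj]]; apply: ord_inj; rewrite -gi -gj.
rewrite (eq_bigr (fun i => ((alpha * fine (loop_measure (cell i))) ^+ loop_count k i /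
    (loop_count k i)`!%:R * expR (- (alpha * fine (loop_measure (cell i)))))%:E)); last first.
  by move=> i _; rewrite -fnu; exact: Ppois.
rewrite prodEFin; congr EFin; rewrite big_split/= mulrC; congr (_ * _).
  by rewrite -expR_sum; congr expR; rewrite sumrN -mulr_sumr lm_sum.
rewrite big_ord_recr/= loop_count_max expr0 fact0 divr1 mulr1.
apply: eq_bigr => j _; rewrite loop_count_widen cell_widen.
by rewrite /loop_measure esum_set1.
Qed.

(** The weights of the loops of a configuration multiply to prod P^n, which
does not depend on the configuration. *)
Lemma Pr_edge_field_eq n ell : (\sum_uv n uv <= K)%N ->
  loop_measure [set: uloop P] = ell%:E ->
  Pr (edge_field_eq L n) = (expR (- (alpha * ell)) * (\prod_x \prod_y P x y ^+ n (x, y)) *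
    exp_coef (fun i => alpha / (multiplicity (lp i))%:R) cross K n)%:E.
Proof.
move=> nK ellE; rewrite edge_field_config// measure_fin_bigcup//=; last 2 first.
- move=> k k' _ _ [w [/configP[wk _] /configP[wk' _]]].
  by apply/ffunP => i; apply: ord_inj; rewrite -wk -wk'.
- by move=> k _; exact: measurable_config.
rewrite (fsbigE (enum [pred k | total_is cross n k])) ?enum_uniq//; last 2 first.
- by move=> k /=; rewrite mem_enum.
- by move=> k /= nk; rewrite mem_enum inE nk.
under eq_bigr do rewrite (Pr_config _ ellE).
rewrite sumEFin; congr EFin; rewrite -mulrA -mulr_sumr; congr (_ * _).
rewrite /exp_coef mulr_sumr big_enum_cond/=.
apply: eq_big => [k|k /andP[+ _]].
  by apply/andP/idP => [[]//|nk]; split => //; exact: mem_set.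
rewrite inE => nk.
have -> : \prod_x \prod_y P x y ^+ n (x, y) = \prod_i weight (lp i) ^+ k i.
  rewrite pair_big/=.
  under eq_bigr => uv _ do
    rewrite -surjective_pairing -(eqP (forallP nk uv)) -prodrXr.
  rewrite exchange_big/=; apply: eq_bigr => i _.
  rewrite /weight prod_count_mem -prodrXl; apply: eq_bigr => -[u v] _.
  by rewrite mulnC exprM.
rewrite -big_split/=; apply: eq_bigr => i _.
by rewrite mulrA exprMn mulrAC mulrC.
Qed.

End Configurations.

End LoopSoupFields.

Theorem theorem1p3 (R : realType) (V : finType) (P : V -> V -> R) (alpha : R)
    (d : measure_display) (Omega : measurableType d) (Pr : probability Omega R)
    (L : Omega -> uloop P -> nat) :
  submarkov P -> transient P -> 0 < alpha -> loop_soup Pr alpha L ->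
  star_forest P ->
  [/\ (forall (q : V -> nat) (n : {ffun V * V -> nat}), Tq P q n ->
        Pr (edge_field_eq L n) =
          (\det (1%:M - tmx P) `^ alpha / Gamma alpha ^+ ncomp P
             * field_term P alpha q n)%:E),
      (forall q : V -> nat,
        Pr (theta_eq L q) =
          (\det (1%:M - tmx P) `^ alpha / Gamma alpha ^+ ncomp P
             * \sum_(n \in Tq P q) field_term P alpha q n)%:E) &
      (forest P -> forall q : V -> nat, Tq P q !=set0 ->
        exists nq, Tq P q = [set nq] /\
          Pr (theta_eq L q) = Pr (edge_field_eq L nq))].
Proof.
move=> Psub Ptr alpha0 Lsoup Pfor.
have [ell ellE detE] := loop_mass_total Psub Ptr.
have detP : \det (1%:M - tmx P) `^ alpha = expR (- (alpha * ell)).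
  have -> : \det (1%:M - tmx P) = expR (- ell).
    rewrite expRN; apply: (mulIf (lt0r_neq0 (expR_gt0 ell))).
    by rewrite detE mulVf// gt_eqF// expR_gt0.
  by rewrite -expRM mulNr mulrC.
have Gam_gt0 (m : nat) : 0 < Gamma (m%:R + alpha).
  by apply: Gamma_gt0; rewrite ltr_wpDl.
have GamS (m : nat) : Gamma (m.+1%:R + alpha) = (m%:R + alpha) * Gamma (m%:R + alpha).
  by rewrite -natr1 addrAC Gamma_succ// ltr_wpDl.
have PrN q n : Tq P q n -> Pr (edge_field_eq L n) =
    (\det (1%:M - tmx P) `^ alpha / Gamma alpha ^+ ncomp P * field_term P alpha q n)%:E.
  move=> nq; have [ns _ _] := nq.
  rewrite (Pr_edge_field_eq Psub Lsoup (leqnn _) ellE) detP.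
  rewrite (exp_coef_loops alpha0 Pfor Gam_gt0 GamS ns (Tq_sym Pfor nq) (leqnn _)).
  by rewrite -[in RHS]mulrA (field_termE Pfor alpha nq) -mulrA [in LHS](mulrC (\prod_x _)).
have PrT q : Pr (theta_eq L q) = (\det (1%:M - tmx P) `^ alpha / Gamma alpha ^+ ncomp P
             * \sum_(n \in Tq P q) field_term P alpha q n)%:E.
  rewrite theta_edge_field measure_fin_bigcup//; last 3 first.
  - exact: finite_Tq.
  - move=> n n' _ _ [w [wn wn']]; apply/ffunP => -[x y]; apply/eqP.
    by rewrite -(eqr_nat R) -eqe -(wn x y) -(wn' x y).
  - move=> n nq; rewrite (edge_field_config L (leqnn _)).
    by apply: fin_bigcup_measurable => // k _; exact: (measurable_config Lsoup).
  rewrite (eq_fsbigr (fun n => (\det (1%:M - tmx P) `^ alpha / Gamma alpha ^+ ncomp P *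
      field_term P alpha q n)%:E)); last by move=> n /set_mem nq; exact: PrN.
  rewrite fsumEFin; last exact: finite_Tq.
  congr EFin; rewrite !fsbig_finite; [|exact: finite_Tq..].
  by rewrite mulr_sumr.
split; [exact: PrN|exact: PrT|move=> [_ noloop] q [nq Tnq]; exists nq].
have TqE : Tq P q = [set nq].
  by apply/seteqP; split => [n nn|_ ->] //=; exact: (Tq_inj Pfor noloop nn Tnq).
by split; [exact: TqE|rewrite (PrN _ _ Tnq) PrT TqE fsbig_set1].
Qed.
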